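(* For every dimension $d\geq 1$ and every $\alpha\in(0,1)$, there is a $\beta\in(0,1)$ such that the following holds. Let $\mathcal{C}$ be a finite family of convex sets in $\mathbb{R}^d$. Assume that among all subfamilies of $\mathcal{C}$ of size $3d+1$, there are at least $\alpha\binom{|\mathcal{C}|}{3d+1}$ for which the intersection of the $3d+1$ members is of volume at least one. Then there is a subfamily $\mathcal{C}'\subset\mathcal{C}$ of size at least $\beta|\mathcal{C}|$ such that the intersection of all members of $\mathcal{C}'$ is of volume at least $d^{-cd^2}$ with a universal constant $c>0$.
   Context: Volume means $d$-dimensional Lebesgue measure. That $c$ is universal means that it does not depend on $d$, $\alpha$ or $\mathcal{C}$; the number $\beta$ depends only on $d$ and $\alpha$.
   Formalization: The family is assumed to have at least 3d+1 members; with fewer, the binomial coefficient is 0, the assumption is void, and the family consisting of the empty set alone is a counterexample. *)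

(* Defs.v *)
From HB Require Import structures.
From mathcomp Require Import all_boot all_order all_algebra.
From mathcomp Require Import all_classical all_reals all_analysis.

Set Implicit Arguments.
Unset Strict Implicit.
Unset Printing Implicit Defensive.

Import Order.TTheory GRing.Theory Num.Theory.
Import numFieldNormedType.Exports.

Local Open Scope classical_set_scope.
Local Open Scope ring_scope.

Section Volume.
Context (R : realType) (d : nat).
Implicit Types (a b : 'rV[R]_d) (A : set 'rV[R]_d).

Definition box a b : set 'rV[R]_d :=
  [set x | forall i, a 0 i < x 0 i <= b 0 i].

Definition box_volume a b : R := \prod_(i < d) (b 0 i - a 0 i).

(* The condition a <= b excludes reversed corners, for which box_volume is not
   the volume of the (empty) box. *)
Definition box_cover A : set (nat -> 'rV[R]_d * 'rV[R]_d) :=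
  [set F : nat -> 'rV[R]_d * 'rV[R]_d |
           (forall k i, (F k).1 0 i <= (F k).2 0 i) /\
           A `<=` \bigcup_k box (F k).1 (F k).2].

(* d-dimensional Lebesgue measure, defined on every set as the Lebesgue outer
   measure (as mathcomp-analysis does on the line with mu_ext); for d >= 1 it is
   a measure on volume.-cara.-measurable, the sigma-algebra of Lebesgue
   measurable sets. Convex sets are Lebesgue measurable but need not be Borel
   when d >= 2. *)
Definition volume A : \bar R :=
  ereal_inf [set (\sum_(k <oo) (box_volume (F k).1 (F k).2)%:E)%E
            | F in box_cover A].

End Volume.

Section VolumeOuterMeasure.
Context (R : realType) (d : nat).
Local Open Scope ereal_scope.
Implicit Types A B : set 'rV[R]_d.

Let vol (p : 'rV[R]_d * 'rV[R]_d) : \bar R := (box_volume p.1 p.2)%:E.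

Lemma box_cover_ge0 A F k : box_cover A F -> 0 <= vol (F k).
Proof.
by move=> [leF _]; rewrite lee_fin prodr_ge0// => i _; rewrite subr_ge0.
Qed.

Lemma volume_ge0 A : 0 <= volume A.
Proof.
apply: le_ereal_inf_tmp => x [F cF <-{x}].
by apply: nneseries_ge0 => k _ _; exact: box_cover_ge0 cF.
Qed.

Lemma le_volume : {homo @volume R d : A B / A `<=` B >-> A <= B}.
Proof.
move=> A B AB; apply/ereal_inf_le_tmp => x [F [leF BF] <-{x}].
by exists F => //; split => //; exact: subset_trans AB BF.
Qed.

Lemma volume_sigma_subadditive : sigma_subadditive (@volume R d).
Proof.
move=> A; have [[i ioo]|] := pselect (exists i, volume (A i) = +oo).
  rewrite (eseries_pinfty _ _ ioo) ?leey// => n _.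
  by rewrite -ltNye (lt_le_trans _ (volume_ge0 _)).
rewrite -forallNE => Aoo.
suff add2e (e : {posnum R}) :
    volume (\bigcup_n A n) <= \sum_(i <oo) volume (A i) + e%:num%:E.
  by apply/lee_addgt0Pr => _/posnumP[].
rewrite (le_trans _ (epsilon_trick _ _ _))//; last first.
  by move=> n; exact: volume_ge0.
pose P n (B : nat -> 'rV[R]_d * 'rV[R]_d) := box_cover (A n) B /\
  \sum_(k <oo) vol (B k) <= volume (A n) + (e%:num / (2 ^ n.+1)%:R)%:E.
have [G PG] : {G : nat -> nat -> 'rV[R]_d * 'rV[R]_d & forall n, P n (G n)}.
  apply: (@choice _ _ P) => n; rewrite /P.
  have fA : volume (A n) \is a fin_num.
    by rewrite ge0_fin_numE ?volume_ge0// ltey; exact/eqP/Aoo.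
  have e0 : (0 < e%:num / (2 ^ n.+1)%:R :> R)%R by [].
  have [x [B cB <-] Bx] := lb_ereal_inf_adherent e0 fA.
  by exists B; split => //; exact/ltW.
have G0 x : 0 <= (vol \o uncurry G) x.
  by case: x => n k; exact: box_cover_ge0 (PG n).1.
apply: (@le_trans _ _ (\esum_(i in setT) (vol \o uncurry G) i)).
  apply: ereal_inf_lbound => /=.
  have /card_esym/ppcard_eqP[f] := card_nat2.
  exists (uncurry G \o f).
    split => [k i|]; first by rewrite /=; case: (f k) => n m; exact: (PG n).1.1.
    move=> t [n _ /((PG n).1.2)[m _ tnm]].
    by exists (f^-1%FUN (n, m)) => //=; rewrite invK ?inE.
  rewrite -(esum_pred_image (vol \o uncurry G) _ xpredT) ?[fun=> _]set_true//.
  by rewrite image_eq.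
rewrite (_ : esum _ _ = \sum_(i <oo) \sum_(j <oo) vol (G i j)); last first.
  pose J : nat -> set (nat * nat) := fun i => [set (i, j) | j in setT].
  rewrite (_ : setT = \bigcup_k J k); last first.
    by rewrite predeqE => -[a b]; split => // _; exists a => //; exists b.
  rewrite esum_bigcupT /=; last 2 first.
    - apply/trivIsetP => i j _ _ ij.
      rewrite predeqE => -[n m] /=; split => //= -[] [_] _ [<-{n} _].
      by move=> [m' _] [] /esym/eqP; rewrite (negbTE ij).
    - exact: G0.
  rewrite -(image_id [set: nat]) -fun_true esum_pred_image//; last first.
    by move=> n _; apply: esum_ge0 => m _; exact: G0.
  apply: eq_eseriesr => /= j _.
  rewrite -(esum_pred_image (vol \o uncurry G) (pair j) predT)//=; last 2 first.
    - by move=> k _; exact: (G0 (j, k)).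
    - by move=> ? ? _ _; exact: (@can_inj _ _ _ snd).
  by congr esum; rewrite predeqE => -[a b]; split; move=> [i _ <-]; exists i.
apply: lee_lim.
- apply: is_cvg_nneseries => n *.
  by apply: nneseries_ge0 => m *; exact: (G0 (n, m)).
- by apply: is_cvg_nneseries => n *; apply: adde_ge0 => //; exact: volume_ge0.
- by near=> n; apply: lee_sum => i _; exact: (PG i).2.
Unshelve. all: by end_near. Qed.

End VolumeOuterMeasure.

(* In dimension 0 every box is the whole space, so set0 has volume 1. *)
Lemma volume0 (R : realType) (n : nat) : volume (set0 : set 'rV[R]_n.+1) = 0%E.
Proof.
apply/eqP; rewrite eq_le volume_ge0 andbT; apply: ereal_inf_lbound.
exists (fun=> (0, 0)); first by split.
by rewrite eseries0// => k _ _; rewrite /box_volume/= big_ord_recl subrr mul0r.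
Qed.

HB.instance Definition _ (R : realType) (n : nat) :=
  isOuterMeasure.Build R 'rV[R]_n.+1 (@volume R n.+1) (volume0 R n)
    (@volume_ge0 R n.+1) (@le_volume R n.+1) (@volume_sigma_subadditive R n.+1).

(* Main.v *)
Require Import Defs.
From HB Require Import structures.
From mathcomp Require Import all_boot all_order all_fingroup all_algebra.
From mathcomp Require Import all_classical all_reals all_analysis.
From mathcomp Require Import measurable_realfun.
From mathcomp Require Import zify ring lra.

Import Order.TTheory GRing.Theory Num.Theory.
Import numFieldNormedType.Exports.

Set Implicit Arguments.
Unset Strict Implicit.
Unset Printing Implicit Defensive.

Local Open Scope ring_scope.

(** Call a subfamily of 3d + 1 sets good if its intersection has volume at
    least one. The theorem follows by counting once each good subfamily [S]
    has a member [i] such that the other 3d sets determine, up to a number of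
    choices that depends on d only, a parallelepiped of volume at least
    [d ^ (- c d ^ 2)] contained in all of [S], in particular in the [i]-th set.
    Indeed [S] is then recorded by the 3d-set [S :\ i] and one of boundedly
    many labels; some such record is shared by a positive fraction of the
    largest conceivable number of subfamilies, that is, by [beta * n] different
    members [i], and all of them contain the same parallelepiped
    ([exists_dense_extensions]).

    Dropping a member. A bounded convex set [K] with interior points lies
    between a parallelepiped [P] and its enlargement by the factor 5d: inscribe
    a simplex of nearly maximal volume ([convex_parallelepiped_sandwich]). Take
    [K] to be the intersection of [S], in coordinates that make [P] the unit
    cube. The claim is that for some [i] the intersection of the sets other than
    the [i]-th lies in the cube enlarged by a factor [F] depending on d only
    ([exists_drop_one_bounded]). Otherwise there is for each [i] a far away
    point [x i] in all the sets but the [i]-th. Among more than 2d nonzero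
    vectors there is a linear relation whose positive part
    [\sum_i max (c i) 0 x i] is not zero ([exists_balanced_relation]). That
    positive part is, up to sign, also the negative part of the relation; the
    first description puts it (after scaling) into the [k]-th set when
    [c k <= 0], the second one when [c k > 0]. So it is a point of [K], and it
    is too far away. A compactness argument on the directions of the [x i]
    makes [F] uniform; the unit cube inside every set absorbs the error between
    the actual directions and their limit.

    Finitely many parallelepipeds. Write [L] for the intersection of the 3d
    remaining sets. The parallelepipeds [P] produced by all the possible [i] lie
    between [L] shrunk by [F] and [L], so measured in the coordinates of one of
    them they have bounded size and are not thin. If two of them have nearly the
    same centre and axes, then each contains the copy of the other one shrunk by
    two; rounding centre and axes to a grid gives the labels
    ([exists_common_core_coloring]). Although nothing is known about [F], it
    does not enter the volume: up to a factor [(C d) ^ d], with a constant [C],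
    the volume of [P] is at least that of a simplex found in a convex set of
    volume at least one ([convex_volume_ge1]). So it is at least
    [(C' d) ^ (- 2 d)], and this exceeds [d ^ (- 9 d ^ 2)] when [d >= 2].

    For [d = 1] the bound is one and nothing may be lost, but there the situation
    is simpler: among three intervals one contains the intersection of the two
    others ([interval_drop_one]), so the intersection over [S :\ i] itself
    serves as the common set.

    The volume enters through two facts: a linear map multiplies it by at most
    the absolute value of its determinant ([volume_linear_image_le], checked on
    elementary matrices), and a box cannot be covered more cheaply than by
    itself ([box_volume_le_volume]). *)

(** * Elementary matrices generate *)

(** Matrices act on row vectors from the right, so the last constructor is the
    shear that adds to [x] the multiple [x 0 k *: c] of a row vector [c] with
    [k]-th coordinate zero: it moves points parallel to the hyperplanes on which
    the [k]-th coordinate is constant. Singular diagonal matrices are included. *)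
Inductive elementary_product (F : fieldType) n : 'M[F]_n -> Prop :=
| EProdMul A B : elementary_product A -> elementary_product B ->
    elementary_product (A *m B)
| EProdDiag (D : 'rV[F]_n) : elementary_product (diag_mx D)
| EProdPerm (s : 'S_n) : elementary_product (perm_mx s)
| EProdShear (k : 'I_n) (c : 'rV[F]_n) : c 0 k = 0 ->
    elementary_product (1%:M + delta_mx k 0 *m c).

Section Generation.
Variable F : fieldType.

Let lift1 n (A : 'M[F]_n) : 'M[F]_(1 + n) := block_mx 1%:M 0 0 A.

Lemma elementary_product_lift n (A : 'M[F]_n) :
  elementary_product A -> elementary_product (lift1 A).
Proof.
elim=> {A} [A B _ IHA _ IHB|D|s|k c ck].
- rewrite (_ : lift1 _ = lift1 A *m lift1 B); first exact: EProdMul.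
  by rewrite /lift1 mulmx_block !(mul1mx, mulmx0, mul0mx, addr0, add0r).
- rewrite (_ : lift1 _ = diag_mx (row_mx 1%:M D)); first exact: EProdDiag.
  rewrite /lift1 diag_mx_row; congr block_mx.
  by apply/matrixP => i j; rewrite !mxE !ord1 !eqxx.
- rewrite (_ : lift1 _ = perm_mx (lift0_perm s)); first exact: EProdPerm.
  by rewrite -lift0_mx_perm.
- rewrite (_ : lift1 _ = 1%:M + delta_mx (rshift 1 k) 0 *m row_mx 0 c).
    by apply: EProdShear; rewrite row_mxEr.
  rewrite (_ : delta_mx (rshift 1 k) 0 = col_mx 0 (delta_mx k 0)); last first.
    apply/matrixP => i j; case: (split_ordP i) => i' ->.
      by rewrite col_mxEu !mxE eq_lrshift.
    by rewrite col_mxEd !mxE eq_rshift.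
  rewrite mul_col_row !(mulmx0, mul0mx) (_ : 1%:M = block_mx 1 0 0 1%:M).
    by rewrite add_block_mx !(addr0, add0r).
  by rewrite -scalar_mx_block.
Qed.

(** The block lower triangular factor of the pivoting step is not itself a shear
    in the sense above, but a product of shears with a single nonzero coefficient
    each: their off-diagonal parts multiply to zero. *)
Lemma elementary_product_low n (c : 'cV[F]_n) :
  elementary_product (block_mx (1%:M : 'M[F]_1) 0 c 1%:M).
Proof.
pose e k : 'M[F]_(1 + n) := delta_mx (rshift 1 k) (lshift n (0 : 'I_1)).
suff P (s : seq 'I_n) :
    elementary_product (1%:M + \sum_(k <- s) c k 0 *: e k).
  rewrite (_ : block_mx _ _ _ _ = 1%:M + \sum_k c k 0 *: e k); first exact: P.
  rewrite scalar_mx_block (_ : \sum_k c k 0 *: e k = block_mx 0 0 c 0).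
    by rewrite add_block_mx !(addr0, add0r).
  apply/matrixP => i j; rewrite summxE.
  case: (split_ordP i) => i' ->; case: (split_ordP j) => j' ->;
   rewrite ?(block_mxEul, block_mxEur, block_mxEdl, block_mxEdr) ?mxE.
  - by rewrite big1 // => k _; rewrite !mxE eq_lrshift mulr0.
  - by rewrite big1 // => k _; rewrite !mxE eq_lrshift mulr0.
  - rewrite (bigD1 i') //= big1 => [|k ki].
      by rewrite !mxE !eqxx !ord1 eqxx mulr1 addr0.
    by rewrite !mxE eq_rshift eq_sym (negPf ki) mulr0.
  - by rewrite big1 // => k _; rewrite !mxE eq_rlshift andbF mulr0.
elim: s => [|k s IH].
  rewrite big_nil addr0 -diag_const_mx; exact: EProdDiag.
rewrite big_cons.
have ek : c k 0 *: e k = delta_mx (rshift 1 k) (0 : 'I_1) *m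
    (c k 0 *: delta_mx (0 : 'I_1) (lshift n (0 : 'I_1))).
  by rewrite -scalemxAr mul_delta_mx.
have /EProdMul/(_ IH) : elementary_product (1%:M + c k 0 *: e k).
  by rewrite ek; apply: EProdShear; rewrite !mxE eq_rlshift andbF mulr0.
congr elementary_product.
rewrite mulmxDr mulmx1 mulmxDl mul1mx mulmx_sumr [X in _ + (_ + X)]big1 => [|i _].
  by rewrite addr0 addrA.
by rewrite -scalemxAl -scalemxAr /e mul_delta_mx_0 ?scaler0 // eq_lrshift.
Qed.

(** Gaussian elimination around a nonzero corner entry [a]: clearing the first
    column and the first row leaves the Schur complement [B - a^-1 *: c *m r]. *)
Lemma elementary_product_pivot n (A : 'M[F]_(1 + n)) :
  (forall B : 'M[F]_n, elementary_product B) ->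
  A (lshift n 0) (lshift n 0) != 0 -> elementary_product A.
Proof.
move=> IH A0; set a := A _ _ in A0.
pose r := ursubmx A; pose c := dlsubmx A; pose B := drsubmx A.
have aE : ulsubmx A = a%:M.
  by apply/matrixP => i j; rewrite !mxE !ord1 eqxx /a; congr (A _ _); apply: val_inj.
rewrite (_ : A = block_mx 1%:M 0 (a^-1 *: c) 1%:M *m
   (lift1 (B - a^-1 *: c *m r) *m (diag_mx (row_mx a%:M (const_mx 1)) *m
   (1%:M + delta_mx (lshift n (0 : 'I_1)) 0 *m row_mx 0 (a^-1 *: r))))).
  apply: EProdMul; first exact: elementary_product_low.
  apply: EProdMul; first exact/elementary_product_lift/IH.
  apply: EProdMul; first exact: EProdDiag.
  by apply: EProdShear; rewrite row_mxEl mxE.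
rewrite -[LHS]submxK aE -/r -/c -/B diag_mx_row diag_const_mx.
rewrite (_ : delta_mx (lshift n _) 0 = col_mx 1%:M 0 :> 'cV[F]_(1 + n)).
  rewrite mul_col_row !(mulmx0, mul0mx, mul1mx) [X in X + block_mx _ _ _ _]scalar_mx_block.
  rewrite add_block_mx !(addr0, add0r).
  rewrite !mulmx_block !(mulmx0, mul0mx, mulmx1, mul1mx, addr0, add0r).
  have -> : diag_mx a%:M = a%:M :> 'M[F]_1.
    by apply/matrixP => i j; rewrite !mxE !ord1 eqxx.
  rewrite mul_scalar_mx scalerA divff // scale1r mul_mx_scalar scalerA divff //.
  by rewrite scale1r addrC subrK.
apply/matrixP => i j; case: (split_ordP i) => i' ->.
  by rewrite col_mxEu !mxE !ord1 eqxx.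
by rewrite col_mxEd !mxE eq_rlshift.
Qed.

Theorem matrix_elementary_product n (A : 'M[F]_n) : elementary_product A.
Proof.
elim: n A => [|n IH] A; first by rewrite [A]flatmx0 -[0](flatmx0 (diag_mx 0)); exact: EProdDiag.
have [->|/matrix0Pn[i [j Aij]]] := eqVneq A 0.
  rewrite (_ : 0 = diag_mx 0); first exact: EProdDiag.
  by apply/matrixP => i j; rewrite !mxE mul0rn.
rewrite -[n.+1]/(1 + n)%N in A i j Aij *.
pose o := lshift n (0 : 'I_1).
have -> : A = perm_mx (tperm o i) *m (xrow o i (xcol o j A) *m perm_mx (tperm o j)).
  rewrite xrowE xcolE !mulmxA -perm_mxM tperm2 perm_mx1 mul1mx -mulmxA -perm_mxM tperm2.
  by rewrite perm_mx1 mulmx1.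
apply: EProdMul; first exact: EProdPerm.
apply: EProdMul; last exact: EProdPerm.
by apply: elementary_product_pivot => //; rewrite !mxE !tpermL.
Qed.
End Generation.

(** * Linear relations that split evenly *)

Lemma submx_add_row (F : fieldType) m d (U : 'M[F]_(m, d)) (x y : 'rV[F]_d) :
  (x <= U + y)%MS -> exists b, ((x - b *: y)%R <= U)%MS.
Proof.
move=> /sub_addsmxP[[D1 D2] /= ->]; exists (D2 0 0).
by rewrite [D2]mx11_scalar mxE eqxx mul_scalar_mx addrK submxMl.
Qed.

(** Everything is read modulo the row space of [U]. Pass to the quotient by one
    more vector [u k0]. The codimension drops by one, and at most two vectors of
    the family are lost: [u k0] itself, and those that become zero because they
    are multiples of it. A positive multiple already gives the conclusion, with
    the two-term relation [u i - l *: u j], and so do two negative multiples,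
    which are positive multiples of each other. A relation of the quotient lifts
    by changing its coefficient at [k0] only, which does not affect the positive
    part modulo [u k0]. This is why twice the codimension is the right count;
    the vectors [e_i] and [- e_i] show that it cannot be lowered. *)
Lemma exists_balanced_dependency (R : realFieldType) d (I : finType) (u : I -> 'rV[R]_d)
    k (U : 'M[R]_d) (T : {set I}) :
  (d - \rank U <= k)%N -> (2 * k < #|T|)%N -> {in T, forall i, ~~ (u i <= U)%MS} ->
  exists c : I -> R, ((\sum_i c i *: u i)%R <= U)%MS /\
    ~~ ((\sum_i Num.max (c i) 0 *: u i)%R <= U)%MS.
Proof.
elim: k U T => [|k IH] U T codimU cardT TU.
  have /card_gt0P[i iT] : (0 < #|T|)%N by [].
  have := TU i iT; rewrite submx_full // /row_full eqn_leq rank_leq_col /=; lia.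
have /card_gt0P[k0 k0T] : (0 < #|T|)%N by lia.
pose one (i j : I) : R := (j == i)%:R.
have sum_one i : \sum_j one i j *: u j = u i.
  rewrite (bigD1 i) //= big1 => [|j ji]; first by rewrite /one eqxx scale1r addr0.
  by rewrite /one (negPf ji) scale0r.
pose parallel i j := exists2 l : R, 0 < l & ((u i - l *: u j)%R <= U)%MS.
have par_done i j : i \in T -> i != j -> parallel i j ->
    exists c : I -> R, ((\sum_i c i *: u i)%R <= U)%MS /\
    ~~ ((\sum_i Num.max (c i) 0 *: u i)%R <= U)%MS.
  move=> iT ij [l l0 lU]; exists (fun h => one i h - l * one j h); split.
    under eq_bigr do rewrite scalerBl -scalerA.
    by rewrite sumrB -scaler_sumr !sum_one.
  rewrite (eq_bigr (fun h => one i h *: u h)) ?sum_one ?TU // => h _; congr (_ *: _).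
  rewrite /one; have [->|hi] := eqVneq h i; first by rewrite (negPf ij) mulr0 subr0 max_l.
  by rewrite max_r // sub0r oppr_le0 mulr_ge0 ?(ltW l0).
pose U' := (U + u k0)%MS; pose T' := [set i in T | ~~ (u i <= U')%MS].
have rankU' : (\rank U < \rank U')%N.
  have UU' : (U <= U')%MS by rewrite addsmxSl.
  rewrite ltn_neqAle !(mxrank_leqif_sup UU') andbT.
  by apply: contra (TU _ k0T); apply: submx_trans; rewrite addsmxSr.
have coef i : i \in T :\: T' -> exists2 b, ((u i - b *: u k0)%R <= U)%MS & b != 0.
  rewrite !inE; case iT: (i \in T); rewrite ?andbF //= andbT negbK.
  move=> /submx_add_row[b bU]; exists b => //; apply: contraTneq bU => ->.
  by rewrite scale0r subr0 TU.
have [/existsP[i /existsP[j /and4P[iD jD ij /andP[ik jk]]]]|] := boolP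
  [exists i, exists j, [&& i \in T :\: T', j \in T :\: T', i != j & (i != k0) && (j != k0)]].
  have [b bU b0] := coef i iD; have [c cU c0] := coef j jD.
  have iT : i \in T by move: iD; rewrite inE => /andP[].
  have jT : j \in T by move: jD; rewrite inE => /andP[].
  have [bp|bn] := ltP 0 b; first by apply: (par_done i k0) => //; exists b.
  have [cp|cn] := ltP 0 c; first by apply: (par_done j k0) => //; exists c.
  apply: (par_done i j) => //; exists (b / c).
    by rewrite nmulr_rgt0 ?invr_lt0 lt_neqAle ?b0 ?c0.
  have -> : u i - (b / c) *: u j = (u i - b *: u k0) - (b / c) *: (u j - c *: u k0).
    by rewrite scalerBr scalerA divfK // opprB addrA subrK.
  by rewrite addmx_sub // eqmx_opp scalemx_sub.
rewrite negb_exists => /forallP few.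
have cardD : (#|T :\: T'| <= 2)%N.
  rewrite (cardsD1 k0) -[2%N]/(1 + 1)%N leq_add ?leq_b1 //.
  apply/card_le1_eqP => i j; rewrite !in_setD1 => /andP[ik iD] /andP[jk jD].
  apply/eqP/negPn/negP => ij; have := few i; rewrite negb_exists => /forallP/(_ j).
  by rewrite iD jD ik jk 1?eq_sym ij.
have cardT' : (2 * k < #|T'|)%N.
  have := cardsID T' T; have := subset_leq_card (subsetIr T T'); lia.
have [|||c [cU' ncU']] := IH U' T' => //; first lia.
  by move=> i; rewrite inE => /andP[].
have [l lU] := submx_add_row cU'.
exists (fun h => c h - l * one k0 h); split.
  under eq_bigr do rewrite scalerBl -scalerA.
  by rewrite sumrB -scaler_sumr sum_one.
apply: contra ncU' => sU; pose e h := Num.max (c h) 0 - Num.max (c h - l * one k0 h) 0.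
have -> : \sum_i Num.max (c i) 0 *: u i =
    \sum_i Num.max (c i - l * one k0 i) 0 *: u i + e k0 *: u k0.
  rewrite -(sum_one k0) scaler_sumr -big_split; apply: eq_bigr => h _ /=.
  rewrite scalerA -scalerDl; congr (_ *: _); rewrite /one.
  have [->|hk] := eqVneq h k0; last by rewrite !mulr0 subr0 addr0.
  by rewrite /e /one !eqxx !mulr1 addrC subrK.
apply: addmx_sub; first exact: submx_trans sU (addsmxSl _ _).
by apply: scalemx_sub; rewrite addsmxSr.
Qed.

Lemma exists_balanced_relation (R : realFieldType) d (I : finType) (u : I -> 'rV[R]_d) :
  (2 * d < #|I|)%N -> (forall i, u i != 0) ->
  exists c : I -> R, [/\ \sum_i `|c i| <= 1, \sum_i c i *: u i = 0 &
    \sum_i Num.max (c i) 0 *: u i != 0].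
Proof.
move=> cardI u0.
have [||i _|c []] := @exists_balanced_dependency R d I u d 0 [set: I]%SET.
- by rewrite leq_subr.
- by rewrite cardsT.
- by rewrite submx0.
rewrite !submx0 => /eqP cu0 cu1.
pose s := \sum_i `|c i|; have s0 : 0 <= s by apply: sumr_ge0.
have s1 : 0 < s + 1 by lra.
exists (fun i => (s + 1)^-1 * c i); split.
- under eq_bigr do rewrite normrM gtr0_norm ?invr_gt0 //.
  by rewrite -mulr_sumr ler_pdivrMl // mulr1 -/s; lra.
- under eq_bigr do rewrite -scalerA.
  by rewrite -scaler_sumr cu0 scaler0.
rewrite (eq_bigr (fun i => (s + 1)^-1 *: (Num.max (c i) 0 *: u i))) => [|i _].
  by rewrite -scaler_sumr scaler_eq0 negb_or cu1 andbT invr_eq0 gt_eqF.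
by rewrite scalerA maxr_pMr ?mulr0 // invr_ge0 ltW.
Qed.

(** * Counting extensions of a subfamily *)

Section FractionalCounting.
Variables (I K : finType) (m : nat) (G : {set {set I}}) (drop : {set I} -> I)
  (col : {set I} -> K).
Hypothesis GP : {in G, forall S : {set I}, #|S| = m.+1 /\ drop S \in S}.

(** The members that [drop] removes from a member of [G] of label [k], leaving
    exactly [B]. *)
Definition extensions (B : {set I}) (k : K) : {set I} :=
  [set i | [&& i \notin B, i |: B \in G, drop (i |: B) == i & col (i |: B) == k]].

(** The map sending [S] to the pair of [S :\ drop S] and [col S] has at most
    ['C(#|I|, m) * #|K|] values, and on a fibre [S] can be recovered from
    [drop S]; so some fibre provides many extensions. *)
Lemma exists_many_extensions : (0 < #|G|)%N ->
  exists B k, (#|G| <= 'C(#|I|, m) * #|K| * #|extensions B k|)%N.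
Proof.
move=> /card_gt0P[S0 S0G].
pose h S := (S :\ drop S, col S).
pose P (x : {set I} * K) := #|x.1| == m.
have hP S : S \in G -> P (h S).
  by move=> /GP[cS dS]; have := cardsD1 (drop S) S; rewrite cS dS /P /= => -[->].
pose x0 := [arg max_(x > h S0 | P x) #|extensions x.1 x.2|].
have xmax x : P x -> (#|extensions x.1 x.2| <= #|extensions x0.1 x0.2|)%N.
  by rewrite /x0; case: arg_maxnP => [|y Py ymax]; [exact: hP|exact: ymax].
exists x0.1, x0.2.
rewrite -sum1_card (partition_big h P) //=.
have cardP : #|[pred x | P x]| = ('C(#|I|, m) * #|K|)%N.
  rewrite -card_draws -cardsT -cardsX; apply: fintype.eq_card => -[B k].
  by rewrite !inE /= andbT.
rewrite -cardP -sum_nat_const; apply: leq_sum => x Px.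
rewrite sum1_card; apply: leq_trans (xmax x Px).
rewrite -(@card_in_imset _ _ drop); last first.
  move=> S S' /andP[SG /eqP hS] /andP[S'G /eqP hS'] dSS'.
  have [_ dS] := GP SG; have [_ dS'] := GP S'G.
  have [e _] : S :\ drop S = S' :\ drop S' /\ col S = col S'.
    by move: hS; rewrite -hS' /h => -[].
  by rewrite -(finset.setD1K dS) e dSS' (finset.setD1K dS').
apply/subset_leq_card/fintype.subsetP => _ /imsetP[S /andP[SG /eqP<-] ->]; have [_ dS] := GP SG.
by rewrite finset.in_set /h /= finset.setD1K // finset.in_setD1 !eqxx SG.
Qed.

(** The binomial coefficients compare by [(m + 1) C(N, m + 1) = (N - m) C(N, m)],
    and [N <= (m + 1) (N - m)] since [m < N]. *)
Lemma exists_dense_extensions (R : realFieldType) (alpha : R) :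
  0 < alpha -> (m.+1 <= #|I|)%N -> alpha * 'C(#|I|, m.+1)%:R <= #|G|%:R ->
  exists B k, alpha / ((m.+1 ^ 2 * #|K|).+1)%:R * #|I|%:R <= #|extensions B k|%:R.
Proof.
move=> a0 mI aG; have binI : (0 < 'C(#|I|, m.+1))%N by rewrite bin_gt0.
have G0 : (0 < #|G|)%N.
  by rewrite -(ltr0n R); apply: lt_le_trans aG; rewrite mulr_gt0 // ltr0n.
have [B [k GE]] := exists_many_extensions G0; exists B, k.
set e := #|extensions B k| in GE *.
have bin0 : (0 < 'C(#|I|, m))%N by rewrite bin_gt0 ltnW.
have h1 : alpha * (#|I| - m)%:R <= (m.+1 * #|K| * e)%:R.
  rewrite -(@ler_pM2l _ 'C(#|I|, m)%:R) ?ltr0n // mulrCA -natrM [X in X%:R](mulnC).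
  rewrite -mul_bin_left natrM -natrM mulnC natrM mulrA.
  apply: (@le_trans _ _ (#|G|%:R * m.+1%:R)); first by rewrite ler_wpM2r.
  rewrite -!natrM ler_nat; apply: leq_trans (leq_mul GE (leqnn _)) _; nia.
have h2 : (#|I| <= m.+1 * (#|I| - m))%N by nia.
rewrite mulrAC ler_pdivrMr ?ltr0n //.
apply: (@le_trans _ _ (alpha * (m.+1 * (#|I| - m))%:R)).
  by rewrite ler_pM2l // ler_nat.
rewrite natrM mulrCA; apply: (@le_trans _ _ (m.+1%:R * (m.+1 * #|K| * e)%:R)).
  by rewrite ler_pM2l ?ltr0n.
by rewrite -!natrM ler_nat; nia.
Qed.

End FractionalCounting.

Local Open Scope classical_set_scope.
Local Open Scope ring_scope.

(** * Boxes have their volume *)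

(** A weighted family of boxes that covers every point of a box with total weight
    at least one has total weighted volume at least that of the box. Weights make
    the induction on the dimension work: fixing the last coordinate turns the
    family into one of lower dimension whose weights are multiplied by indicators
    of intervals, and the resulting inequality is integrated over the last
    coordinate. Points are sequences, so that the dimension is only the number of
    coordinates that count. *)
Lemma interval_count_le (R : realType) d (a b : nat -> R) (c : nat -> R) (l r : nat -> nat -> R) :
  (forall i, a i <= b i) -> (forall k, 0 <= c k) -> (forall k i, l k i <= r k i) ->
  (forall x : nat -> R, (forall i, (i < d)%N -> x i \in `]a i, b i]) ->
     (1 <= \sum_(k <oo) (c k * \prod_(i < d) (x i \in `]l k i, r k i])%:R)%:E)%E) ->
  ((\prod_(i < d) (b i - a i))%:E <= \sum_(k <oo) (c k * \prod_(i < d) (r k i - l k i))%:E)%E.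
Proof.
move=> leab + lelr; elim: d c => [|d IH] c c0 H.
  rewrite big_ord0; apply: le_trans (H a _) _ => //.
  by apply: lee_nneseries => k _; rewrite ?lee_fin !big_ord0 ?mulr1.
pose P k : R := \prod_(i < d) (r k i - l k i).
have P0 k : 0 <= P k by apply: prodr_ge0 => i _; rewrite subr_ge0.
pose D : set (measurableTypeR R) := `]a d, b d]%classic.
pose f k (y : measurableTypeR R) : \bar R := ((c k * P k)%:E * (\1_(`]l k d, r k d]%classic) y)%:E)%E.
have f0 k y : (0 <= f k y)%E by rewrite mule_ge0 // lee_fin mulr_ge0.
have mf k : measurable_fun D (f k).
  apply: measurable_funeM; apply/measurable_EFinP; exact: measurable_indic.
have step y : D y -> ((\prod_(i < d) (b i - a i))%:E <= \sum_(k <oo) f k y)%E.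
  move=> Dy; have := IH (fun k => c k * (y \in `]l k d, r k d])%:R).
  have -> : (\sum_(k <oo) f k y = \sum_(k <oo) (c k * (y \in `]l k d, r k d])%:R * P k)%:E)%E.
    apply: eq_eseriesr => k _; rewrite /f -EFinM indicE; congr (_%:E).
    by rewrite mem_setE mulrAC.
  apply => [k|x xab]; first by rewrite mulr_ge0.
  have := H (fun i => if i == d then y else x i).
  have -> : (\sum_(k <oo) (c k * (y \in `]l k d, r k d])%:R *
        \prod_(i < d) (x i \in `]l k i, r k i])%:R)%:E =
     \sum_(k <oo) (c k * \prod_(i < d.+1)
        ((if i == d :> nat then y else x i) \in `]l k i, r k i])%:R)%:E)%E.
    apply: eq_eseriesr => k _; congr (_%:E); rewrite big_ord_recr /= eqxx.
    rewrite mulrAC mulrA; congr (_ * _ * _); apply: eq_bigr => i _.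
    by rewrite ltn_eqF.
  apply=> i; rewrite ltnS leq_eqVlt => /orP[/eqP ->|id]; first by rewrite eqxx.
  by rewrite ltn_eqF //; exact: xab.
have muI (u v : R) : u <= v -> lebesgue_measure `]u, v]%classic = (v - u)%:E.
  move=> uv; rewrite lebesgue_measure_itv /= lte_fin EFinB.
  case: ltgtP uv => // [->] _; by rewrite subee.
rewrite big_ord_recr /= EFinM -(muI _ _ (leab d)).
rewrite -integral_cst; last exact: measurable_itv.
apply: (@le_trans _ _ (\int[lebesgue_measure]_(y in D) \sum_(k <oo) f k y)%E).
  apply: ge0_le_integral => //.
  - by move=> x _; rewrite lee_fin prodr_ge0 // => i _; rewrite subr_ge0.

  - exact: ge0_emeasurable_sum.
have mD : measurable D by exact: measurable_itv.
rewrite (integral_nneseries lebesgue_measure mD mf (fun k y _ => f0 k y)).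
apply: lee_nneseries => k _; first by move=> _; apply: integral_ge0.
have mI : measurable_fun D (fun y => (\1_(`]l k d, r k d]%classic) y)%:E : \bar R).
  by apply/measurable_EFinP; exact: measurable_indic.
have cP : (0 <= (c k * P k)%:E)%E by rewrite lee_fin mulr_ge0.
rewrite /f (ge0_integralZl lebesgue_measure mD mI) //.
rewrite integral_indic // big_ord_recr /= mulrA [leRHS]EFinM.
apply: lee_wpmul2l; first by rewrite lee_fin mulr_ge0.
by rewrite -muI //; apply: le_measure; rewrite ?inE //; exact: measurableI.
Qed.

Lemma box_volume_le_volume (R : realType) d (a b : 'rV[R]_d) :
  (forall i, a 0 i <= b 0 i) -> ((box_volume a b)%:E <= volume (box a b))%E.
Proof.
move=> leab; apply: le_ereal_inf_tmp => _ [F [leF cF] <-].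
pose g (v : 'rV[R]_d) (i : nat) : R := if insub i is Some j then v 0 j else 0.
have gE v (i : 'I_d) : g v i = v 0 i by rewrite /g valK.
have gle (u v : 'rV[R]_d) : (forall i, u 0 i <= v 0 i) -> forall i, g u i <= g v i.
  by move=> uv i; rewrite /g; case: insubP.
have := @interval_count_le R d (g a) (g b) (fun=> 1) (fun k => g (F k).1) (fun k => g (F k).2).
under eq_bigr do rewrite !gE.
under eq_eseriesr => k _.
  rewrite mul1r; under eq_bigr do rewrite !gE.
over.
apply => //; [exact: gle|by move=> k; apply: gle|move=> x xab].
have /cF[k _ xk] : box a b (\row_i x i).
  by move=> i; have := xab i (ltn_ord i); rewrite in_itv /= !gE mxE.
rewrite (@nneseriesD1 _ _ k) // => [|i _]; last first.
  by rewrite lee_fin mul1r prodr_ge0.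
rewrite big1 => [|i _]; last by have := xk i; rewrite mxE in_itv /= !gE => ->.
by rewrite mulr1 leeDl // nneseries_ge0 // => i _ _; rewrite lee_fin mul1r prodr_ge0.
Qed.

(** * Linear maps and volume *)

(** Cramer's rule: replacing the [j]-th row by a combination of the rows multiplies
    the determinant by the [j]-th coefficient. *)
Lemma det_subst_row (K : comPzRingType) n (A : 'M[K]_n) (j : 'I_n) (t : 'rV[K]_n) :
  \det (\matrix_i (if i == j then t *m A else row i A)) = t 0 j * \det A.
Proof.
pose T : 'M[K]_n := \matrix_i (if i == j then t else row i 1%:M).
rewrite (_ : \matrix_i _ = T *m A).
  rewrite det_mulmx; congr (_ * _); rewrite (expand_det_row T j).
  have adj1E : \adj (1%:M : 'M[K]_n) = 1%:M.
    by rewrite -[LHS]mul1mx mul_mx_adj det1.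
  rewrite (bigD1 j) //= big1 => [|k kj].
    rewrite addr0 !mxE eqxx (_ : cofactor T j j = (\adj 1%:M : 'M[K]_n) j j).
      by rewrite adj1E mxE eqxx mulr1.
    rewrite mxE /cofactor; congr (_ * \det _); apply/matrixP => r s.
    by rewrite !mxE eq_sym (negPf (neq_lift _ _)) !mxE.
  rewrite (_ : cofactor T j k = (\adj 1%:M : 'M[K]_n) k j).
    by rewrite adj1E [X in _ * X]mxE (negPf kj) mulr0.
  rewrite mxE /cofactor; congr (_ * \det _); apply/matrixP => r s.
  by rewrite !mxE eq_sym (negPf (neq_lift _ _)) !mxE.
apply/row_matrixP => i; rewrite row_mul !rowK; case: ifP => // _.
by rewrite -row_mul mul1mx.
Qed.

Section LinearImage.
Variables (R : realType) (n : nat).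
Local Notation V := 'rV[R]_n.+1.
Implicit Types (a b x : V) (E : set V) (A : 'M[R]_n.+1).

Lemma volume_box_le a b :
  (forall i, a 0 i <= b 0 i) -> (volume (box a b) <= (box_volume a b)%:E)%E.
Proof.
move=> leab; apply: ereal_inf_lbound.
exists (fun k : nat => if k == 0%N then (a, b) else (0, 0)).
  by split => [[|k] i //|x xab]; exists 0%N.
rewrite (@nneseriesD1 _ _ 0) //=; last first.
  by move=> [|k] _ /=; rewrite lee_fin prodr_ge0 // => i _; rewrite subr_ge0.
rewrite eseries0 ?adde0 // => -[|k] _ //= _.
by rewrite /box_volume big_ord_recl subrr mul0r.
Qed.

Lemma cvg_prod_seq (I : Type) (r : seq I) (f : I -> nat -> R) (l : I -> R) :
  (forall i, f i m @[m --> \oo] --> l i) ->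
  \prod_(i <- r) f i m @[m --> \oo] --> \prod_(i <- r) l i.
Proof.
move=> fl; elim: r => [|i r IH].
  rewrite big_nil; under eq_cvg do rewrite big_nil; exact: cvg_cst.
rewrite big_cons; under eq_cvg do rewrite big_cons; exact: cvgM.
Qed.

(** The passage to the limit that turns bounds with thickened sides into sharp
    ones. *)
Lemma le_prod_harmonic (v : \bar R) (l k : 'I_n.+1 -> R) :
  (forall N, (v <= (\prod_j (l j + k j * harmonic N))%:E)%E) ->
  (v <= (\prod_j l j)%:E)%E.
Proof.
move=> le_v.
have cvg_l : (\prod_j (l j + k j * harmonic N))%:E @[N --> \oo] --> (\prod_j l j)%:E.
  apply: cvg_EFin; first by apply: nearW.
  apply: cvg_prod_seq => j; rewrite -[X in _ --> X]addr0 -[X in _ + X](mulr0 (k j)).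
  apply: cvgD; first exact: cvg_cst.
  by apply: cvgM; [exact: cvg_cst|exact: cvg_harmonic].
rewrite -(cvg_lim _ cvg_l) //; apply: lime_ge.
  by apply/cvg_ex; exists (\prod_j l j)%:E.
exact: nearW.
Qed.

(** Boxes are half-open, and images of boxes under maps that reverse a coordinate
    or collapse it are covered by half-open boxes only after thickening. *)
Lemma volume_closed_box_le a b E : (forall i, a 0 i <= b 0 i) ->
  (forall x, E x -> forall i, a 0 i <= x 0 i <= b 0 i) ->
  (volume E <= (box_volume a b)%:E)%E.
Proof.
move=> leab Eab; apply: (@le_prod_harmonic _ _ (fun=> 1)) => N.
pose a' : V := \row_i (a 0 i - harmonic N).
have h0 : 0 < harmonic N :> R := harmonic_gt0 N.
apply: (@le_trans _ _ (volume (box a' b))).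
  apply: le_volume => x /Eab xab i; case/andP: (xab i) => ax ->; rewrite andbT mxE.
  by rewrite ltrBlDr (le_lt_trans ax) // ltrDl.
apply: le_trans (volume_box_le _) _ => [i|].
  by rewrite mxE (le_trans _ (leab i)) // gerBl ltW.
rewrite lee_fin /box_volume le_eqVlt; apply/orP; left; apply/eqP.
by apply: eq_bigr => i _; rewrite mxE; ring.
Qed.

(** A map that distorts the volume of boxes by at most [c] does so for all sets, by
    covering. Finiteness of the volume avoids the product of zero and infinity
    for singular maps. *)
Lemma volume_image_le (f : V -> V) (c : R) : 0 <= c ->
  (forall a b, (forall i, a 0 i <= b 0 i) ->
     (volume (f @` box a b) <= (c * box_volume a b)%:E)%E) ->
  forall E, (volume E < +oo)%E -> (volume (f @` E) <= c%:E * volume E)%E.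
Proof.
move=> c0 fbox E Eoo.
have Efin : volume E \is a fin_num by rewrite ge0_fin_numE // volume_ge0.
have c1 : 0 < c + 1 by rewrite ltr_wpDl.
apply/lee_addgt0Pr => e e0.
have e0' : 0 < e / (c + 1) by rewrite divr_gt0.
have [_ [F [leF EF] <-] costF] := lb_ereal_inf_adherent e0' Efin.
have F0 k : (0 <= (box_volume (F k).1 (F k).2)%:E)%E.
  by apply: (box_cover_ge0 k (conj leF EF)).
apply: (@le_trans _ _ (volume (\bigcup_k (f @` box (F k).1 (F k).2)))).
  apply: le_volume => _ [x /EF[k _ xk] <-]; exists k => //; by exists x.
apply: le_trans (volume_sigma_subadditive _) _.
apply: (@le_trans _ _ (\sum_(k <oo) (c%:E * (box_volume (F k).1 (F k).2)%:E))%E).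
  apply: lee_nneseries => [k _ _|k _]; first exact: volume_ge0.
  by rewrite -EFinM; exact: fbox.
rewrite nneseriesZl //.
apply: (@le_trans _ _ (c%:E * (volume E + (e / (c + 1))%:E))%E).
  by apply: lee_wpmul2l; rewrite ?lee_fin // ltW.
rewrite muleDr //; last by rewrite fin_num_adde_defl.
by rewrite leeD2l // -EFinM lee_fin mulrA ler_pdivrMr // mulrDr mulr1 mulrC lerDl ltW.
Qed.

Let scales A := forall E, (volume E < +oo)%E ->
  (volume ((mulmx^~ A) @` E) <= `|\det A|%:E * volume E)%E.

Let scales_box A : (forall a b, (forall i, a 0 i <= b 0 i) ->
     (volume ((mulmx^~ A) @` box a b) <= (`|\det A| * box_volume a b)%:E)%E) -> scales A.
Proof. by move=> Abox E; exact: volume_image_le. Qed.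

Let scales_mul A B : scales A -> scales B -> scales (A *m B).
Proof.
move=> sA sB E Eoo.
have EAoo : (volume ((mulmx^~ A) @` E) < +oo)%E.
  apply: le_lt_trans (sA E Eoo) _; rewrite lte_mul_pinfty ?lee_fin //.
rewrite (_ : _ @` E = (mulmx^~ B) @` ((mulmx^~ A) @` E)); last first.
  by rewrite image_comp; congr image; apply/funext => x /=; rewrite mulmxA.
apply: le_trans (sB _ EAoo) _; rewrite det_mulmx normrM mulrC EFinM -muleA.
by apply: lee_wpmul2l => //; exact: sA.
Qed.

Let scales_diag (D : V) : scales (diag_mx D).
Proof.
apply: scales_box => a b leab.
pose u : V := \row_i Num.min (a 0 i * D 0 i) (b 0 i * D 0 i).
pose v : V := \row_i Num.max (a 0 i * D 0 i) (b 0 i * D 0 i).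
rewrite (_ : _ * box_volume a b = box_volume u v).
  apply: volume_closed_box_le => [i|_ [x xab <-] i].
    by rewrite !mxE ge_min !le_max lexx.
  rewrite mul_mx_diag !mxE; case/andP: (xab i) => /ltW ax xb.
  have [D0|/ltW D0] := leP 0 (D 0 i).
    by rewrite ge_min le_max (ler_wpM2r D0 ax) (ler_wpM2r D0 xb) orbT.
  by rewrite ge_min le_max (ler_wnM2r D0 ax) (ler_wnM2r D0 xb) orbT.
rewrite det_diag normr_prod -big_split; apply: eq_bigr => i _ /=; rewrite !mxE.
have [D0|/[dup]/ltW D0 D0'] := leP 0 (D 0 i).
  rewrite min_l ?max_r ?ler_wpM2r // ger0_norm //; ring.
rewrite min_r ?max_l ?ler_wnM2r // ltr0_norm //; ring.
Qed.

Let scales_perm (s : 'S_n.+1) : scales (perm_mx s).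
Proof.
apply: scales_box => a b leab.
have pE (x : V) j : (x *m perm_mx s) 0 j = x 0 ((s^-1)%g j).
  by rewrite -[s]invgK -col_permE mxE invgK.
rewrite det_perm normrX normrN1 expr1n mul1r.
rewrite (_ : box_volume a b = box_volume (a *m perm_mx s) (b *m perm_mx s)).
  apply: volume_closed_box_le => [i|_ [x xab <-] i]; rewrite !pE //.
  by case/andP: (xab ((s^-1)%g i)) => /ltW -> ->.
rewrite /box_volume (reindex_inj (@perm_inj _ (s^-1)%g)); apply: eq_bigr => i _.
by rewrite !pE.
Qed.

Let shearE (k : 'I_n.+1) (c x : V) :
  x *m (1%:M + delta_mx k 0 *m c) = x + x 0 k *: c.
Proof.
rewrite mulmxDr mulmx1 mulmxA; congr (_ + _); apply/rowP => j.
rewrite !mxE big_ord1; congr (_ * _).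
rewrite mxE (bigD1 k) //= big1 ?mxE ?eqxx ?mulr1 ?addr0 // => i ik.
by rewrite mxE (negPf ik) mulr0.
Qed.

Let det_shear (k : 'I_n.+1) (c : V) : c 0 k = 0 ->
  \det (1%:M + delta_mx k 0 *m c) = 1.
Proof.
move=> ck; transitivity ((row k 1%:M + c) 0 k * \det (1%:M : 'M[R]_n.+1)).
  rewrite -det_subst_row; congr (\det _).
  apply/row_matrixP => i; rewrite rowK; case: eqP => [->|/eqP ik].
    rewrite mulmx1 linearD /= row_mul; congr (_ + _).
    by apply/rowP => j; rewrite !mxE big_ord1 !mxE !eqxx mul1r.
  rewrite linearD /= row_mul (_ : row i (delta_mx k 0) = 0) ?mul0mx ?addr0 //.
  by apply/rowP => j; rewrite !mxE (negPf ik).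
by rewrite det1 mulr1 !mxE ck eqxx addr0.
Qed.

(* Cut the box into thin slices across the k-th direction. On a slice the shear is
   a translation up to the product of its thickness h and |c j|, so that its image
   lies in a box whose j-th side grew by that much. *)
Let scales_shear (k : 'I_n.+1) (c : V) : c 0 k = 0 ->
  scales (1%:M + delta_mx k 0 *m c).
Proof.
move=> ck; apply: scales_box => a b leab; rewrite det_shear // normr1 mul1r.
pose L := b 0 k - a 0 k; have L0 : 0 <= L by rewrite subr_ge0.
apply: (@le_prod_harmonic _ _ (fun j => `|c 0 j| * L)) => N.
pose h := L * harmonic N.
have h0 : 0 <= h by rewrite mulr_ge0 // harmonic_ge0.
have hN : N.+1%:R * h = L by rewrite /h /= mulrCA divff ?mulr1 ?pnatr_eq0.
pose p s : V := \row_j (if j == k then a 0 k + s%:R * h else a 0 j).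
pose q s : V := \row_j (if j == k then a 0 k + s.+1%:R * h else b 0 j).
have lepq s i : p s 0 i <= q s 0 i.
  by rewrite !mxE; case: eqP => // _; rewrite lerD2l ler_wpM2r // ler_nat.
pose u s : V := \row_j (p s 0 j + Num.min (p s 0 k * c 0 j) (q s 0 k * c 0 j)).
pose v s : V := \row_j (q s 0 j + Num.max (p s 0 k * c 0 j) (q s 0 k * c 0 j)).
pose f (x : V) : V := x *m (1%:M + delta_mx k 0 *m c).
have sub : f @` box a b `<=` \big[setU/set0]_(s < N.+1) (f @` box (p s) (q s)).
  move=> _ [x xab <-]; rewrite -(bigcup_mkord N.+1 (fun s => f @` box (p s) (q s))).
  have [axk xbk] := andP (xab k).
  have ex : exists s, x 0 k <= a 0 k + s.+1%:R * h.
    by exists N; rewrite hN /L addrC subrK.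
  case: (ex_minnP ex) => s xs smin; exists s => /=.
    by rewrite ltnS; apply: smin; rewrite hN /L addrC subrK.
  exists x => // j; rewrite !mxE; case: eqP => [->|_]; last exact: xab.
  rewrite xs andbT; case: s smin {xs} => [|s] smin; first by rewrite mul0r addr0.
  by rewrite ltNge; apply/negP => /smin; rewrite ltnn.
apply: le_trans (le_volume sub) _.
apply: le_trans (outer_measure_subadditive (@volume R n.+1) (fun s => f @` box (p s) (q s)) N.+1) _.
have vol_slice s : (volume (f @` box (p s) (q s)) <=
    (h * \prod_(j | j != k) (b 0 j - a 0 j + `|c 0 j| * h))%:E)%E.
  rewrite (_ : _ * _ = box_volume (u s) (v s)).
    apply: volume_closed_box_le => [i|_ [x xpq <-] i].
      by rewrite !mxE lerD // ?ge_min ?le_max ?lexx //; have := lepq s i; rewrite !mxE.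
    rewrite /f shearE [u s 0 i]mxE [v s 0 i]mxE [(x + _) 0 i]mxE [(x 0 k *: c) 0 i]mxE.
    case/andP: (xpq i) => /ltW px xq; case/andP: (xpq k) => /ltW pk qk.
    have [c0|/ltW c0] := leP 0 (c 0 i).
      by rewrite !lerD // ?ge_min ?le_max ?(ler_wpM2r c0 pk) ?(ler_wpM2r c0 qk) ?orbT.
    by rewrite !lerD // ?ge_min ?le_max ?(ler_wnM2r c0 pk) ?(ler_wnM2r c0 qk) ?orbT.
  have qpk : q s 0 k - p s 0 k = h.
    by rewrite !mxE eqxx -natr1; ring.
  rewrite /box_volume [RHS](bigD1 k) //=; congr (_ * _).
    by rewrite [v s 0 k]mxE [u s 0 k]mxE ck !mulr0 minxx maxxx !addr0 qpk.
  apply: eq_bigr => j jk; rewrite [v s 0 j]mxE [u s 0 j]mxE -qpk.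
  have -> : q s 0 j = b 0 j by rewrite mxE (negPf jk).
  have -> : p s 0 j = a 0 j by rewrite mxE (negPf jk).
  have pqk := lepq s k.
  have [c0|/[dup]/ltW c0 c0'] := leP 0 (c 0 j).
    rewrite min_l ?max_r ?ler_wpM2r // ger0_norm //; ring.
  rewrite min_r ?max_l ?ler_wnM2r // ltr0_norm //; ring.
apply: (@le_trans _ _ (\sum_(s < N.+1)
    (h * \prod_(j | j != k) (b 0 j - a 0 j + `|c 0 j| * h))%:E)%E).
  by apply: lee_sum => s _; exact: vol_slice.
rewrite sumEFin lee_fin sumr_const card_ord -[leLHS]mulr_natl mulrA hN.
rewrite [leRHS](bigD1 k) //= ck normr0 !mul0r addr0 le_eqVlt; apply/orP; left.
by apply/eqP; congr (_ * _); apply: eq_bigr => j _; rewrite /h mulrA.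
Qed.

Theorem volume_linear_image_le A E : (volume E < +oo)%E ->
  (volume ((mulmx^~ A) @` E) <= `|\det A|%:E * volume E)%E.
Proof.
have sA : scales A.
  elim: (matrix_elementary_product A) => [B C _ sB _ sC|D|s|k c ck].
  - exact: scales_mul.
  - exact: scales_diag.
  - exact: scales_perm.
  - exact: scales_shear.
exact: sA.
Qed.

Lemma volume_translate_le (p : V) E : (volume E < +oo)%E ->
  (volume ((fun x : V => (p + x)%R) @` E) <= volume E)%E.
Proof.
move=> Eoo; rewrite -[leRHS]mul1e; apply: volume_image_le => // a b leab.
rewrite mul1r (_ : box_volume a b = box_volume (p + a) (p + b)).
  apply: volume_closed_box_le => [i|_ [x xab <-] i]; rewrite !mxE lerD2l //.
  by rewrite lerD2l; case/andP: (xab i) => /ltW -> ->.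
by apply: eq_bigr => i _; rewrite !mxE; ring.
Qed.
End LinearImage.

(** * Parallelepipeds and convex sets *)

Section Parallelepipeds.
Variables (R : realType) (n : nat).
Local Notation V := 'rV[R]_n.+1.
Local Notation d := (n.+1).
Implicit Types (p q v x t : V) (K E : set V) (A M N : 'M[R]_n.+1).

Lemma rV_norm_leP t (c : R) : 0 <= c -> (`|t| <= c) <-> (forall i, `|t 0 i| <= c).
Proof.
move=> c0; rewrite [`|t|]mx_normrE; split => [/bigmax_leP[_ H] i|H].
  exact: (H (0, i)).
by apply/bigmax_leP; split => // -[i j] _; rewrite /= (ord1 i).
Qed.

Definition parallelepiped p M : set V := [set p + t *m M | t in [set t | `|t| <= 1]].

Lemma parallelepipedZ p M (r : R) x : 0 < r ->
  parallelepiped p (r *: M) x <-> exists2 t, `|t| <= r & x = p + t *m M.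
Proof.
move=> r0; split => [[t /= t1 <-]|[t tr ->]].
  exists (r *: t); first by rewrite normrZ gtr0_norm // ger_pMr.
  by rewrite -scalemxAr -scalemxAl.
exists (r^-1 *: t); first by rewrite /= normrZ gtr0_norm ?invr_gt0 // ler_pdivrMl ?mulr1.
by rewrite -scalemxAr -scalemxAl scalerA divff ?scale1r // gt_eqF.
Qed.

Let cst_box_volume (a b : R) : box_volume (const_mx a : V) (const_mx b) = (b - a) ^+ d.
Proof.
by rewrite /box_volume (eq_bigr (fun=> b - a)) ?prodr_const ?card_ord // => i _; rewrite !mxE.
Qed.

(** The true constant is [2 ^+ d]; the slack comes from covering the closed cube
    by one half-open box, and only changes the base of an exponential. *)
Lemma volume_parallelepiped_le p M :
  (volume (parallelepiped p M) <= (3 ^+ d * `|\det M|)%:E)%E.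
Proof.
pose Q : set V := [set t | `|t| <= 1].
have volQ : (volume Q <= (3 ^+ d)%:E)%E.
  have QB : Q `<=` box (const_mx (-2)) (const_mx 1).
    move=> t /(@rV_norm_leP _ _ ler01) t1 i; rewrite !mxE.
    by move: (t1 i); rewrite ler_norml => /andP[]; lra.
  apply: le_trans (le_volume QB) _; apply: le_trans (volume_box_le _) _.
    by move=> i; rewrite !mxE; lra.
  by rewrite cst_box_volume lee_fin opprK.
have Qoo : (volume Q < +oo)%E by apply: le_lt_trans volQ _; rewrite ltry.
have MQ := volume_linear_image_le M Qoo.
have MQoo : (volume ((mulmx^~ M) @` Q) < +oo)%E.
  by apply: le_lt_trans MQ _; rewrite lte_mul_pinfty ?lee_fin.
rewrite (_ : parallelepiped p M = (fun x : V => p + x) @` ((mulmx^~ M) @` Q)).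
  apply: le_trans (volume_translate_le p MQoo) _; apply: le_trans MQ _.
  by rewrite mulrC EFinM lee_wpmul2l // lee_fin.
by rewrite image_comp.
Qed.

(** Apply the upper bound for linear images to the inverse of [M], which maps the
    parallelepiped back onto the cube. *)
Lemma volume_parallelepiped_ge p M :
  ((2 ^+ d * `|\det M|)%:E <= volume (parallelepiped p M))%E.
Proof.
have [->|M0] := eqVneq (\det M) 0; first by rewrite normr0 mulr0 volume_ge0.
have uM : M \in unitmx by rewrite unitmxE unitfE.
have [->|Poo] := eqVneq (volume (parallelepiped p M)) +oo%E; first by rewrite leey.
rewrite -ltey in Poo.
have TPle := volume_translate_le (- p) Poo.
have TPoo := le_lt_trans TPle Poo.
have := volume_linear_image_le (invmx M) TPoo.
set Q := _ @` (_ @` _) => Qle.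
have : ((2 ^+ d)%:E <= `|\det (invmx M)|%:E * volume (parallelepiped p M))%E.
  apply: le_trans (le_trans Qle (lee_wpmul2l _ TPle)); last by rewrite lee_fin.
  have BQ : box (const_mx (-1)) (const_mx 1) `<=` Q.
    move=> t tB; exists (t *m M); last by rewrite -mulmxA mulmxV ?mulmx1.
    exists (p + t *m M); last by rewrite addKr.
    exists t => //; apply/(@rV_norm_leP _ _ ler01) => i; have := tB i; rewrite !mxE.
    by rewrite ler_norml => /andP[/ltW -> ->].
  apply: le_trans _ (le_volume BQ); apply: le_trans _ (box_volume_le_volume _).
    by rewrite cst_box_volume opprK.
  by move=> i; rewrite !mxE; lra.
have Pfin : volume (parallelepiped p M) \is a fin_num by rewrite ge0_fin_numE ?volume_ge0.
rewrite -(fineK Pfin) -EFinM !lee_fin det_inv normfV.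
by rewrite [_^-1 * _]mulrC ler_pdivlMr ?normr_gt0.
Qed.

Lemma det_le_parallelepiped p q M N : parallelepiped q N `<=` parallelepiped p M ->
  2 ^+ d * `|\det N| <= 3 ^+ d * `|\det M|.
Proof.
move=> NM; rewrite -lee_fin; apply: le_trans (volume_parallelepiped_ge q N) _.
exact: le_trans (le_volume NM) (volume_parallelepiped_le _ _).
Qed.

End Parallelepipeds.

Section ConvexFrames.
Variables (R : realType) (n : nat).
Local Notation V := 'rV[R]_n.+1.
Local Notation d := (n.+1).
Implicit Types (p q v x t : V) (K E : set V) (A M N : 'M[R]_n.+1).

Lemma convex_setP (U : lmodType R) (C : set (convex_lmodType U)) :
  convex_set C <-> forall (x y : U) (s : R), C x -> C y -> 0 <= s <= 1 ->
    C (s *: x + (1 - s) *: y).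
Proof.
split => [cC x y s Cx Cy /andP[s0 s1]|H x y l].
  have := cC x y (Itv01 s0 s1); rewrite !inE => /(_ Cx Cy); exact.
rewrite !inE => Cx Cy; apply: H => //; by rewrite ge0 le1.
Qed.

Lemma convex_set_sum (I : Type) (r : seq I) (a : I -> R) (x : I -> V) v K :
  convex_set K -> K v -> (forall i, K (v + x i)) -> (forall i, 0 <= a i) ->
  \sum_(i <- r) a i <= 1 -> K (v + \sum_(i <- r) a i *: x i).
Proof.
move=> /convex_setP cK Kv Kx; elim: r a => [|i r IH] a a0.
  by rewrite !big_nil addr0.
rewrite !big_cons => sum1.
have r0 : 0 <= \sum_(j <- r) a j by apply: sumr_ge0.
have [ai1|ai1] := leP 1 (a i).
  have ai : a i = 1 by lra.
  have sr : \sum_(j <- r) a j = 0 by lra.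
  have aj : \sum_(j <- r) a j *: x j = 0.
    elim: r sr {IH sum1 r0} => [|j r IHr]; first by rewrite !big_nil.
    rewrite !big_cons => /eqP; rewrite paddr_eq0 ?sumr_ge0 // => /andP[/eqP -> /eqP/IHr ->].
    by rewrite scale0r addr0.
  by rewrite ai aj addr0 scale1r.
have h : 0 < 1 - a i by lra.
have Kr := IH (fun j => (1 - a i)^-1 * a j).
have : K (v + \sum_(j <- r) ((1 - a i)^-1 * a j) *: x j).
  apply: Kr => [j|]; first by rewrite mulr_ge0 // invr_ge0 ltW.
  by rewrite -mulr_sumr ler_pdivrMl // mulr1; lra.
move=> /(cK _ _ (a i) (Kx i)) /(_ _)/wrap[]; first by rewrite a0 ltW.
congr K; under [X in _ + _ *: (_ + X)]eq_bigr do rewrite -scalerA.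
rewrite -scaler_sumr !scalerDr scalerA divff ?gt_eqF // scale1r.
by rewrite addrACA -scalerDl [a i + _]addrC subrK scale1r.
Qed.

(** The vertices [v] and [v + row i A] of a simplex lie in [K]; when [K] is convex
    so does the simplex, whose volume is [`|\det A| / d!]. *)
Definition simplex_in K v A := K v /\ forall i, K (v + row i A).

(* The point of a simplex with all barycentric-type coefficients equal to w is the
   centre of a parallelepiped with half-axes w times the edges: the coefficients
   then range over [0, 2 w] and add up to at most d * 2 w = 1. *)
Let w : R := (2 * d%:R)^-1.
Let w0 : 0 < w. Proof. by rewrite invr_gt0 mulr_gt0 // ltr0n. Qed.
Let dw : 2 * d%:R * w = 1.
Proof. by rewrite divff // gt_eqF // mulr_gt0 // ltr0n. Qed.

Lemma parallelepiped_sub_simplex K v A : convex_set K -> simplex_in K v A ->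
  parallelepiped (v + w *: (const_mx 1 *m A)) (w *: A) `<=` K.
Proof.
move=> cK [Kv KA] _ [t /(@rV_norm_leP _ _ _ _ ler01) t1 <-].
rewrite -scalemxAr -addrA -scalerDr -mulmxDl mulmx_sum_row scaler_sumr.
under eq_bigr do rewrite scalerA.
apply: convex_set_sum => // [i|].
  rewrite mulr_ge0 ?(ltW w0) // !mxE; have := t1 i; rewrite ler_norml; lra.
rewrite -mulr_sumr -ler_pdivlMl // mulr1 invrK.
apply: (@le_trans _ _ (\sum_(i < d) (2 : R))).
  by apply: ler_sum => i _; rewrite !mxE; have := t1 i; rewrite ler_norml; lra.
by rewrite sumr_const card_ord mulr_natr.
Qed.

(** Take a simplex [(v, A)] in [K] whose determinant is at least half of the
    supremum. If [v + t *m A] lies in [K], then replacing the [j]-th vertex by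
    this point multiplies the determinant by [t 0 j], hence [`|t 0 j| <= 2]. With
    respect to the parallelepiped inscribed in the simplex the coefficients are
    [2 d t - 1], of absolute value at most [4 d + 1 <= 5 d]. *)
Lemma convex_parallelepiped_sandwich K (B : R) : convex_set K ->
  (forall v A, simplex_in K v A -> `|\det A| <= B) ->
  (exists v A, simplex_in K v A /\ \det A != 0) ->
  exists p M, [/\ \det M != 0, parallelepiped p M `<=` K &
    K `<=` parallelepiped p ((5 * d)%:R *: M)].
Proof.
move=> cK KB [v1 [A1 [K1 A10]]].
pose D : set R := [set z | exists v A, simplex_in K v A /\ z = `|\det A|].
have supD : has_sup D.
  split; first by exists `|\det A1|, v1, A1.
  by exists B => _ [v [A [KA ->]]]; exact: KB KA.
have D1 : D `|\det A1| by exists v1, A1.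
have s0 : 0 < sup D.
  by apply: lt_le_trans (ub_le_sup supD.2 D1); rewrite normr_gt0.
have /(sup_adherent)/(_ supD)[_ [v [A [KA ->]]] A2] : 0 < sup D / 2 by rewrite divr_gt0.
have A0 : 0 < `|\det A| by lra.
have uA : A \in unitmx by rewrite unitmxE unitfE -normr_gt0.
have near_max v' A' : simplex_in K v' A' -> `|\det A'| <= 2 * `|\det A|.
  move=> K'; have : `|\det A'| <= sup D by apply: (ub_le_sup supD.2); exists v', A'.
  lra.
exists (v + w *: (const_mx 1 *m A)), (w *: A); split.
- by rewrite detZ mulf_neq0 -?normr_gt0 // normrX exprn_gt0 // normr_gt0 gt_eqF.
- exact: parallelepiped_sub_simplex.
move=> x Kx; apply/parallelepipedZ; first by rewrite ltr0n.
have [t xE] : exists t, x = v + t *m A.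
  by exists ((x - v) *m invmx A); rewrite -mulmxA mulVmx // mulmx1 addrC subrK.
have t2 i : `|t 0 i| <= 2.
  have : `|t 0 i * \det A| <= 2 * `|\det A|.
    rewrite -det_subst_row; apply: (near_max v); split; first exact: KA.1.
    move=> j; rewrite rowK; case: eqP => _; last exact: KA.2.
    by rewrite -xE.
  by rewrite normrM ler_pM2r.
exists ((2 * d%:R) *: t - const_mx 1).
  apply/rV_norm_leP => [|i]; first by rewrite ler0n.
  rewrite !mxE natrM; have := t2 i; rewrite !ler_norml => /andP[t2a t2b].
  have d1 : 1 <= d%:R :> R by rewrite ler1n.
  have dt1 : 0 <= d%:R * (t 0 i + 2) by rewrite mulr_ge0 ?ler0n //; lra.
  have dt2 : 0 <= d%:R * (2 - t 0 i) by rewrite mulr_ge0 ?ler0n //; lra.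
  rewrite mulrDr in dt1; rewrite mulrBr in dt2; rewrite -mulrA.
  apply/andP; split; lra.
rewrite -scalemxAr mulmxBl scalerBr -scalemxAl scalerA mulrC dw scale1r.
by rewrite addrACA subrr addr0.
Qed.

(** A set without nondegenerate simplices lies in a proper affine subspace: choose
    points for which the differences to [v] have the largest possible rank. The
    subspace is a countable union of parallelepipeds with zero determinant. *)
Lemma volume_degenerate K : (forall v A, simplex_in K v A -> \det A = 0) ->
  volume K = 0%E.
Proof.
move=> K0; apply/eqP; rewrite eq_le volume_ge0 andbT.
have [->|/set0P[v Kv]] := eqVneq K set0; first by rewrite volume0.
pose P r := `[< exists m (A : 'M[R]_(m, d)), (forall i, K (v + row i A)) /\ \rank A = r >].
have exP : exists r, P r.
  by exists 0%N; apply/asboolP; exists 0%N, 0; split; [case|rewrite mxrank0].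
have ubP r : P r -> (r <= d)%N.
  by move=> /asboolP[m [A [_ <-]]]; exact: rank_leq_col.
case: (ex_maxnP exP ubP) => r /asboolP[m [A [KA rA]]] rmax.
have KsubA x : K x -> (x - v <= A)%MS.
  move=> Kx; apply/negPn/negP => nxA.
  have := rmax (\rank (col_mx A (x - v))); rewrite leqNgt -rA => /(_ _)/negP; apply.
    apply/asboolP; exists (m + 1)%N, (col_mx A (x - v)); split => // i.
    case: (split_ordP i) => j ->; first by rewrite rowKu.
    by rewrite rowKd row_id addrC subrK.
  have sub : (A <= col_mx A (x - v)%R)%MS by rewrite -addsmxE addsmxSl.
  rewrite ltn_neqAle !(mxrank_leqif_sup sub) andbT; apply: contra nxA.
  by apply: submx_trans; rewrite -addsmxE addsmxSr.
have nfull : ~~ row_full A.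
  apply/negP => fA; have := fullrowsub_unit fA; rewrite unitmxE unitfE => /negP; apply.
  by apply/eqP/(K0 v); split => // i; rewrite row_rowsub.
have detA : \det <<A>>%MS = 0.
  apply/eqP/negPn; rewrite -unitfE -unitmxE -row_full_unit; apply: contra nfull.
  by rewrite /row_full mxrank_gen.
have sub : K `<=` \bigcup_k parallelepiped v (k.+1%:R *: <<A>>%MS).
  move=> x /KsubA; rewrite -(genmxE A) => /submxP[t xt].
  exists (Num.truncn `|t|) => //; apply/parallelepipedZ; first by rewrite ltr0n.
  by exists t; [rewrite ltW // truncnS_gt|rewrite -xt addrC subrK].
apply: le_trans (le_volume sub) _; apply: le_trans (volume_sigma_subadditive _) _.
rewrite eseries0 // => k _ _; apply/eqP; rewrite eq_le volume_ge0 andbT.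
by apply: le_trans (volume_parallelepiped_le _ _) _; rewrite detZ detA mulr0 normr0 mulr0.
Qed.

(** [K] may be unbounded. Either it contains a simplex with determinant at least
    one, or all determinants are bounded by one and [K] lies in an enlarged
    parallelepiped, whose volume is then at least one. *)
Lemma convex_volume_ge1 K : convex_set K -> (1 <= volume K)%E ->
  exists p M, parallelepiped p M `<=` K /\ ((15 * d)%:R ^- d <= `|\det M|).
Proof.
move=> cK K1.
have [[v [A [KA detA]]]|small] := pselect (exists v A, simplex_in K v A /\ 1 <= `|\det A|).
  exists (v + w *: (const_mx 1 *m A)), (w *: A); split.
    exact: parallelepiped_sub_simplex.
  rewrite detZ normrM normrX (gtr0_norm w0).
  apply: (@le_trans _ _ (w ^+ d)); last by rewrite ler_peMr // exprn_ge0 // ltW.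
  rewrite exprVn lef_pV2 ?posrE ?exprn_gt0 ?mulr_gt0 ?ltr0n //.
  by rewrite lerXn2r ?nnegrE ?ler0n ?mulr_ge0 // natrM ler_wpM2r // ler_nat.
have KB v A : simplex_in K v A -> `|\det A| <= 1.
  by move=> KA; rewrite leNgt; apply/negP => /ltW A1; apply: small; exists v, A.
have [nd|deg] := pselect (exists v A, simplex_in K v A /\ \det A != 0).
  have [p [M [M0 MK KM]]] := convex_parallelepiped_sandwich cK KB nd.
  exists p, M; split => //.
  have := le_trans K1 (le_trans (le_volume KM) (volume_parallelepiped_le _ _)).
  rewrite lee_fin detZ normrM normrX ger0_norm ?ler0n // mulrA -exprMn.
  rewrite -natrM mulnA => h; rewrite -[leLHS]mulr1 ler_pdivrMl ?exprn_gt0 ?ltr0n //.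
have := volume_degenerate (K := K) => K0; move: K1; rewrite K0 ?lee_fin ?ler10 //.
move=> v A KA; apply/eqP/negPn/negP => A0; apply: deg; by exists v, A.
Qed.

End ConvexFrames.

(** * Dropping one set: compactness *)

Section DropOne.
Variables (R : realType) (n m : nat).
Local Notation V := 'rV[R]_n.+1.
Local Notation d := (n.+1).

(** Let [zp] and [zm] be the positive and negative parts of the combination. If
    [c k <= 0], then [zp] is a combination of the [y i] with [i != k] and lies in
    [C k]; if [c k > 0] this holds for [zm], and [zp / 2] is the midpoint of [zm]
    and [zp - zm], which lies in the unit ball. So [zp / 2] lies in every
    [C k]. *)
Lemma balanced_relation_bound (C : 'I_m -> set V) (y : 'I_m -> V) (c : 'I_m -> R) (r : R) :
  (forall i, convex_set (C i)) -> (forall i x, `|x| <= 1 -> C i x) ->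
  (forall x, (forall i, C i x) -> `|x| <= r) ->
  (forall i j, j != i -> C j (y i)) ->
  \sum_i `|c i| <= 1 -> `|\sum_i c i *: y i| <= 1 ->
  `|\sum_i Num.max (c i) 0 *: y i| <= 2 * r.
Proof.
move=> cC C1 Cr Cy c1 sumcy; set zp := \sum_i _.
pose zm := \sum_i Num.max (- c i) 0 *: y i.
have C0 k : C k 0 by apply: C1; rewrite normr0.
have mem (a : 'I_m -> R) k : (forall i, 0 <= a i) -> (forall i, a i <= `|c i|) -> a k = 0 ->
    C k (\sum_i a i *: y i).
  move=> a0 ac ak.
  have -> : \sum_i a i *: y i = 0 + \sum_i a i *: (if i == k then 0 else y i).
    rewrite add0r; apply: eq_bigr => i _; case: eqP => // ->.
    by rewrite ak !scale0r.
  apply: convex_set_sum => // [i|].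
    by rewrite add0r; case: eqVneq => // ik; apply: Cy; rewrite eq_sym.
  by apply: le_trans c1; apply: ler_sum.
have zpmE : zp - zm = \sum_i c i *: y i.
  rewrite -sumrB; apply: eq_bigr => i _; rewrite -scalerBl; congr (_ *: _).
  case/orP: (le_total 0 (c i)) => c0.
    by rewrite max_l // max_r ?subr0 // oppr_le0.
  by rewrite max_r // max_l ?oppr_ge0 // sub0r opprK.
have half : 0 <= (2^-1 : R) <= 1 by apply/andP; split; lra.
have halfE : 1 - 2^-1 = 2^-1 :> R by lra.
have Czp k : C k (2^-1 *: zp).
  case/orP: (le_total (c k) 0) => c0.
    have Cz : C k zp.
      apply: mem => [i|i|]; last by rewrite max_r.
        by rewrite le_max lexx orbT.
      by rewrite ge_max normr_ge0 ler_norm.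
    by have := (convex_setP (C k)).1 (cC k) _ _ _ Cz (C0 k) half; rewrite scaler0 addr0.
  have Cz : C k zm.
    apply: mem => [i|i|]; last by rewrite max_r // oppr_le0.
      by rewrite le_max lexx orbT.
    by rewrite ge_max normr_ge0 -normrN ler_norm.
  have Cd : C k (zp - zm) by apply: C1; rewrite zpmE.
  have := (convex_setP (C k)).1 (cC k) _ _ _ Cz Cd half.
  by rewrite halfE -scalerDr addrC subrK.
have := Cr _ Czp; rewrite normrZ gtr0_norm ?invr_gt0 //; lra.
Qed.

(** Suppose that the bounds [N + 1] fail for every [N], with witnesses
    [(s N).2 i] of norm larger than [N + 1]. The directions [w N] of these
    witnesses have a cluster point [u], a family of unit vectors, to which
    the balanced relation applies. Rescaling the relation to a length [F] that
    makes its positive part longer than [2 r], and taking [N] beyond [F] with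
    [w N] close to [u], contradicts [balanced_relation_bound]. *)
Lemma exists_drop_one_bounded (r : R) : (2 * d < m)%N ->
  exists2 F : R, 0 < F & forall C : 'I_m -> set V,
    (forall i, convex_set (C i)) -> (forall i x, `|x| <= 1 -> C i x) ->
    (forall x, (forall i, C i x) -> `|x| <= r) ->
    exists i, forall x, (forall j, j != i -> C j x) -> `|x| <= F.
Proof.
move=> dm; apply: contrapT => noF.
pose bad (N : nat) (Cx : ('I_m -> set V) * ('I_m -> V)) :=
  [/\ forall i, convex_set (Cx.1 i), forall i x, `|x| <= 1 -> Cx.1 i x,
      forall x, (forall i, Cx.1 i x) -> `|x| <= r &
      forall i, N.+1%:R < `|Cx.2 i| /\ forall j, j != i -> Cx.1 j (Cx.2 i)].
have /choice[s sP] : forall N, exists Cx, bad N Cx.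
  move=> N; apply: contrapT => nbad; apply: noF; exists N.+1%:R; first by rewrite ltr0n.
  move=> C cC C1 Cr; apply: contrapT => nex; apply: nbad.
  have /choice[x xP] : forall i, exists x, N.+1%:R < `|x| /\ forall j, j != i -> C j x.
    move=> i; apply: contrapT => nx; apply: nex; exists i => x Cx.
    by rewrite leNgt; apply/negP => Fx; apply: nx; exists x.
  by exists (C, x); split.
pose w N : 'rV[V]_m := \row_i (`|(s N).2 i|^-1 *: (s N).2 i).
have wn N i : `|(s N).2 i| > 0.
  by have [_ _ _ /(_ i)[+ _]] := sP N; apply: lt_trans; rewrite ltr0n.
pose S : set V := [set v | `|v| = 1].
have compS : compact S.
  apply: bounded_closed_compact.
    by exists 1; split; [exact: num_real|move=> M M1 v /= ->; exact: ltW].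
  rewrite (_ : S = (fun v : V => `|v|) @^-1` [set 1]) //.
  apply: closed_comp; last exact: closed_eq.
  by move=> v _; exact: norm_continuous.
have compZ := rV_compact (fun=> compS) (n := m).
have wZ : \forall N \near \oo, forall i, S (w N ord0 i).
  apply: nearW => N i; rewrite /S /= mxE normrZ normfV normr_id mulVf // gt_eqF //.
have [u [uS clu]] := compZ (w @ \oo) _ wZ.
have [|i|c [c1 cu cp]] := @exists_balanced_relation R d 'I_m (fun i => u 0 i).
- by rewrite card_ord.
- by rewrite -normr_gt0 (uS i) ltr01.
set e := \sum_i Num.max (c i) 0 *: u 0 i in cp.
have e0 : 0 < `|e| by rewrite normr_gt0.
pose F := 4 * (`|r| + 1) / `|e|.
have F0 : 0 < F by rewrite divr_gt0 // mulr_gt0 // ltr_wpDl.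
pose eps := Num.min (`|e| / 2) F^-1.
have eps0 : 0 < eps by rewrite lt_min !divr_gt0 //= invr_gt0.
have [_ [[N NF <-] [_ wu]]] : ((w @` [set N | F <= N%:R]) `&` ball u eps) !=set0.
  apply: clu; last exact: nbhsx_ballx.
  have : \forall N \near \oo, F <= N%:R by exact: nbhs_infty_ger.
  by apply: filterS => N FN; exists N.
have [cC C1 Cr xP] := sP N.
pose y i := F *: w N 0 i.
have Cy i j : j != i -> (s N).1 j (y i).
  move=> ji; have [Nx /(_ j ji) Cx] := xP i.
  have C0 : (s N).1 j 0 by apply: C1; rewrite normr0.
  have Fx : 0 <= F / `|(s N).2 i| <= 1.
    rewrite divr_ge0 ?(ltW F0) //= ler_pdivrMr // mul1r ltW // (le_lt_trans NF) //.
    by apply: le_lt_trans Nx; rewrite ler_nat.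
  have := (convex_setP _).1 (cC j) _ _ _ Cx C0 Fx.
  by rewrite scaler0 addr0 /y mxE scalerA.
have close i : `|w N 0 i - u 0 i| < eps.
  by have := wu 0 i; rewrite -ball_normE /ball_ /= distrC.
have sum_close (a : 'I_m -> R) : (forall i, `|a i| <= `|c i|) ->
    `|\sum_i a i *: w N 0 i - \sum_i a i *: u 0 i| <= eps.
  move=> ac; rewrite -sumrB; apply: le_trans (ler_norm_sum _ _ _) _.
  apply: (@le_trans _ _ (\sum_i `|c i| * eps)).
    apply: ler_sum => i _; rewrite -scalerBr normrZ ler_pM // ltW //.
  by rewrite -mulr_suml ger_pMl.
have sumy (a : 'I_m -> R) : \sum_i a i *: y i = F *: \sum_i a i *: w N 0 i.
  by rewrite scaler_sumr; apply: eq_bigr => i _; rewrite /y !scalerA mulrC.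
have := balanced_relation_bound cC C1 Cr Cy c1; rewrite !sumy !(normrZ F) (gtr0_norm F0).
have cw := sum_close c (fun i => lexx _); rewrite cu subr0 in cw.
have Fle : F * `|\sum_i c i *: w N 0 i| <= 1.
  rewrite -ler_pdivlMl // mulr1; apply: le_trans cw _; by rewrite ge_min lexx orbT.
move=> /(_ Fle); apply/negP; rewrite -ltNge.
have pw : `|\sum_i Num.max (c i) 0 *: w N 0 i - e| <= eps.
  apply: sum_close => i; rewrite ger0_norm ?le_max ?lexx ?orbT //.
  by rewrite ge_max normr_ge0 ler_norm.
have epse : eps <= `|e| / 2 by rewrite ge_min lexx.
have big : `|e| / 2 <= `|\sum_i Num.max (c i) 0 *: w N 0 i|.
  have := lerB_dist e (e - \sum_i Num.max (c i) 0 *: w N 0 i).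
  rewrite subKr distrC; lra.
apply: (@lt_le_trans _ _ (F * (`|e| / 2))); last by rewrite ler_pM2l.
have -> : F * (`|e| / 2) = 2 * (`|r| + 1).
  by rewrite /F; field; rewrite gt_eqF.
rewrite ltr_pM2l //; apply: le_lt_trans (ler_norm r) _; by rewrite ltrDl.
Qed.

End DropOne.

(** * Finitely many cores *)

Section CommonCore.
Variables (R : realType) (n : nat).
Local Notation V := 'rV[R]_n.+1.
Local Notation d := (n.+1).
Implicit Types (p q s t x : V) (L : set V) (A M : 'M[R]_n.+1).

Definition sandwiches (F : R) p M L :=
  [/\ \det M != 0, parallelepiped p M `<=` L & L `<=` parallelepiped p (F *: M)].

Lemma rV_mulmx_norm_le t A (a : R) : 0 <= a -> `|t| <= 1 -> (forall i j, `|A i j| <= a) ->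
  `|t *m A| <= d%:R * a.
Proof.
move=> a0 /(@rV_norm_leP _ _ _ _ ler01) t1 Aa.
apply/rV_norm_leP => [|j]; first by rewrite mulr_ge0.
rewrite mxE; apply: le_trans (ler_norm_sum _ _ _) _.
apply: (@le_trans _ _ (\sum_(i < d) a)); last by rewrite sumr_const card_ord mulr_natl.
by apply: ler_sum => i _; rewrite normrM -[leRHS]mul1r ler_pM.
Qed.

(** A point [s' + t *m A' / 2] is the midpoint of [s + t *m A] and of [s + z], where
    [z] collects twice the error of the centres and the error of the axes; both
    belong to the larger parallelepiped. *)
Lemma half_parallelepiped_perturb s A s' A' (rho : R) : 0 < rho ->
  (forall z, `|z| <= rho -> parallelepiped s A (s + z)) ->
  `|s' - s| <= rho / 4 -> (forall i j, `|A' i j - A i j| <= rho / (2 * d%:R)) ->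
  parallelepiped s' (2^-1 *: A') `<=` parallelepiped s A.
Proof.
move=> rho0 ballA ss' AA' _ [t /= t1 <-].
pose z := 2 *: (s' - s) + t *m (A' - A).
have z_le : `|z| <= rho.
  apply: le_trans (ler_normD _ _) _; rewrite normrZ gtr0_norm //.
  have := @rV_mulmx_norm_le t (A' - A) (rho / (2 * d%:R)) _ t1.
  rewrite divr_ge0 ?(ltW rho0) ?mulr_ge0 // => /(_ isT) h.
  have {h} : `|t *m (A' - A)| <= d%:R * (rho / (2 * d%:R)).
    by apply: h => i j; rewrite !mxE.
  rewrite (_ : d%:R * _ = rho / 2); last first.
    have : d%:R != 0 :> R by rewrite pnatr_eq0.
    by move: (d%:R : R) => D D0; field.
  by move: ss'; lra.
have [t' /= t'1 t'E] := ballA z z_le.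
have zE : t' *m A = z by apply: (addrI s); rewrite t'E.
exists (2^-1 *: (t + t')).
  rewrite /= normrZ gtr0_norm ?invr_gt0 //; have := ler_normD t t'; lra.
rewrite -scalemxAl mulmxDl zE -scalemxAr /z mulmxBr.
rewrite [t *m A + _]addrCA [t *m A + _]addrC subrK scalerDr scalerA mulVf ?pnatr_eq0 //.
by rewrite scale1r addrA [s + _]addrC subrK.
Qed.

Definition round_coord (b e : R) (N : nat) (c : R) : 'I_N.+1 := inord (Num.truncn ((c + b) / e)).

Lemma round_coord_close (b e : R) N (x y : R) : 0 < e -> 2 * b / e < N%:R ->
  `|x| <= b -> `|y| <= b -> round_coord b e N x = round_coord b e N y -> `|x - y| <= e.
Proof.
move=> e0 bN xb yb.
have bnd z : `|z| <= b -> 0 <= (z + b) / e /\ (Num.truncn ((z + b) / e) < N.+1)%N.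
  rewrite ler_norml => /andP[zb bz].
  have z0 : 0 <= (z + b) / e by rewrite divr_ge0 ?(ltW e0) //; lra.
  split => //; rewrite ltnS -(ler_nat R); have /andP[+ _] := truncn_itv z0.
  move=> /le_trans; apply.
  apply: le_trans (ltW bN); rewrite ler_pM2r ?invr_gt0 //; lra.
have [x0 xN] := bnd x xb; have [y0 yN] := bnd y yb.
move=> /(congr1 val); rewrite /= !inordK // => xy.
have := truncn_itv x0; have := truncn_itv y0; rewrite xy -natr1 => /andP[y1 y2] /andP[x1 x2].
have : `|(x + b) / e - (y + b) / e| <= 1 by rewrite ler_norml; apply/andP; split; lra.
rewrite -mulrBl opprD addrACA subrr addr0 normrM normfV (gtr0_norm e0) ler_pdivrMr // mul1r //.
Qed.

(** Centre and axes of the parallelepiped [(p, M)] in the coordinates of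
    [(p0, M0)]. *)
Definition rel_center p0 M0 p : V := (p - p0) *m invmx M0.
Definition rel_shape M0 M : 'M[R]_n.+1 := M *m invmx M0.

Lemma parallelepiped_rel p0 M0 p M x : \det M0 != 0 ->
  parallelepiped (rel_center p0 M0 p) (rel_shape M0 M) x <->
  parallelepiped p M (p0 + x *m M0).
Proof.
move=> M00; have uM : M0 \in unitmx by rewrite unitmxE unitfE.
rewrite /rel_center /rel_shape; split => -[t /= t1 tE]; exists t => //.
  by rewrite -tE mulmxDl mulmxA !mulmxKV // addrA [p0 + _]addrC subrK.
apply: (can_inj (mulmxK uM)); rewrite mulmxDl mulmxA !mulmxKV //.
by apply: (addrI p0); rewrite -tE addrA [p0 + _]addrC subrK.
Qed.

(** In the coordinates of [(p0, M0)] the set [L] contains the unit cube and lies in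
    the cube of radius [F]. A parallelepiped with centre [s] that sandwiches [L]
    lies in the cube of radius [F], so its centre and axes are bounded; and its
    [F]-fold enlargement contains the unit cube, so that by symmetry about [s]
    it contains the ball of radius [1 / F] around [s]. Rounding centres and axes
    to a precision that is small compared to [1 / F] gives the colour. *)
Lemma exists_common_core_coloring (F : R) : 1 <= F ->
  exists (K : finType) (col : V -> 'M[R]_n.+1 -> V -> 'M[R]_n.+1 -> K),
  forall p0 M0 p M p' M' L,
    sandwiches F p0 M0 L -> sandwiches F p M L -> sandwiches F p' M' L ->
    col p0 M0 p M = col p0 M0 p' M' ->
    parallelepiped p' (2^-1 *: M') `<=` parallelepiped p M.
Proof.
move=> F1; have F0 : 0 < F by lra.
pose rho := F^-1; have rho0 : 0 < rho by rewrite invr_gt0.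
pose e := rho / (4 * d%:R); have e0 : 0 < e by rewrite divr_gt0 // mulr_gt0 // ltr0n.
pose b := 2 * F; pose N := (Num.truncn (2 * b / e)).+1.
have bN : 2 * b / e < N%:R by exact: truncnS_gt.
pose rd := round_coord b e N.
exists ('rV['I_N.+1]_d * 'M['I_N.+1]_d)%type.
exists (fun p0 M0 p M => (map_mx rd (rel_center p0 M0 p), map_mx rd (rel_shape M0 M))).
move=> p0 M0 p M p' M' L [M00 ML0 LM0].
have uM : M0 \in unitmx by rewrite unitmxE unitfE.
have bounds q Q : sandwiches F q Q L ->
    [/\ `|rel_center p0 M0 q| <= F, forall i j, `|rel_shape M0 Q i j| <= b &
     forall z, `|z| <= rho ->
       parallelepiped (rel_center p0 M0 q) (rel_shape M0 Q) (rel_center p0 M0 q + z)].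
  move=> [Q0 QL LQ]; set s := rel_center p0 M0 q; set A := rel_shape M0 Q.
  have in_cube t : `|t| <= 1 -> `|s + t *m A| <= F.
    move=> t1; have : parallelepiped s A (s + t *m A) by exists t.
    move=> /(parallelepiped_rel _ _ _ _ M00) /QL /LM0 /(parallelepipedZ _ _ _ F0)[t' t'F].
    by move=> /addrI/(can_inj (mulmxK uM)) ->.
  have sF : `|s| <= F by have := in_cube 0; rewrite normr0 mul0mx addr0; apply.
  split => // [i j|z zrho].
    have : `|delta_mx 0 i : V| <= 1.
      apply/rV_norm_leP => // k; rewrite mxE normr_nat; by case: (_ && _).
    move=> /in_cube; rewrite -rowE => sA.
    have : `|row i A| <= b.
      have := ler_normB (s + row i A) s; rewrite addrC addKr /b; lra.
    move=> /rV_norm_leP => /(_ _)/(_ j); rewrite mxE; apply; rewrite /b; lra.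
  have in_A x : `|x| <= 1 -> exists2 t, `|t| <= F & x = s + t *m A.
    move=> x1; have : parallelepiped p0 M0 (p0 + x *m M0) by exists x.
    move=> /ML0 /LQ; rewrite -(parallelepiped_rel p0 q (F *: Q) x M00).
    by rewrite /rel_shape -scalemxAl => /(parallelepipedZ _ _ _ F0).
  have Fz : `|F *: z| <= 1.
    by rewrite normrZ (gtr0_norm F0) -ler_pdivlMl // mulr1.
  have [t1 t1F t1E] := in_A _ Fz.
  have [|t2 t2F t2E] := in_A (- (F *: z)); first by rewrite normrN.
  exists ((2 * F)^-1 *: (t1 - t2)) => /=.
    rewrite normrZ gtr0_norm ?invr_gt0 ?mulr_gt0 // ler_pdivrMl ?mulr_gt0 // mulr1.
    have := ler_normB t1 t2; lra.
  rewrite -scalemxAl mulmxBl.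
  have -> : t1 *m A - t2 *m A = (2 * F) *: z.
    have -> : t1 *m A - t2 *m A = (s + t1 *m A) - (s + t2 *m A) by rewrite opprD addrACA subrr add0r.
    by rewrite -t1E -t2E opprK -mulr2n -scaler_nat scalerA.
  by rewrite scalerA mulVf ?scale1r // gt_eqF // mulr_gt0.
move=> /bounds[sF Ab ballA] /[dup] -[M'0 _ _] /bounds[sF' Ab' _] [cs cA] x.
have {}cs i : `|rel_center p0 M0 p' 0 i - rel_center p0 M0 p 0 i| <= e.
  have le_b (t : V) : `|t| <= F -> `|t 0 i| <= b.
    move=> /(@rV_norm_leP _ _ _ _ (ltW F0))/(_ i); rewrite /b; lra.
  apply: (round_coord_close e0 bN); [exact: le_b|exact: le_b|].
  by move/matrixP/(_ 0 i): cs; rewrite !mxE.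
have {}cA i j : `|rel_shape M0 M' i j - rel_shape M0 M i j| <= e.
  apply: (round_coord_close e0 bN) => //.
  by move/matrixP/(_ i j): cA; rewrite !mxE.
have d1 : 1 <= d%:R :> R by rewrite ler1n.
have e_rho : e <= rho / 4.
  by rewrite /e ler_pM2l // lef_pV2 ?posrE ?mulr_gt0 // ?ltr0n // ler_peMr.
have e_rho2 : e <= rho / (2 * d%:R).
  by rewrite /e ler_pM2l // lef_pV2 ?posrE ?mulr_gt0 // ?ltr0n // ler_pM2r ?ltr0n // ler_nat.
have cs' : `|rel_center p0 M0 p' - rel_center p0 M0 p| <= rho / 4.
  apply/rV_norm_leP => [|i]; first by rewrite divr_ge0 // ltW.
  by rewrite !mxE; have := cs i; rewrite !mxE => /le_trans; apply.
have := half_parallelepiped_perturb rho0 ballA cs' (fun i j => le_trans (cA i j) e_rho2).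
have -> : 2^-1 *: rel_shape M0 M' = rel_shape M0 (2^-1 *: M') by rewrite /rel_shape scalemxAl.
move=> sub xP; pose y := (x - p0) *m invmx M0.
have xE : x = p0 + y *m M0 by rewrite /y mulmxKV // addrC subrK.
by rewrite xE; apply/(parallelepiped_rel _ _ _ _ M00)/sub/(parallelepiped_rel _ _ _ _ M00); rewrite -xE.
Qed.

End CommonCore.

(** * Dropping one set: families of convex sets *)

Section Selection.
Variables (R : realType) (n : nat).
Local Notation V := 'rV[R]_n.+1.
Local Notation d := (n.+1).

Lemma convex_setI (U : lmodType R) (K L : set (convex_lmodType U)) :
  convex_set K -> convex_set L -> convex_set (K `&` L).
Proof.
move=> /convex_setP cK /convex_setP cL; apply/convex_setP => x y s [Kx Lx] [Ky Ly] s01.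
by split; [exact: cK|exact: cL].
Qed.

Lemma convex_bigcap (U : lmodType R) (I : Type) (P : set I) (C : I -> set (convex_lmodType U)) :
  (forall i, convex_set (C i)) -> convex_set (\bigcap_(i in P) C i).
Proof.
move=> cC; apply/convex_setP => x y s Cx Cy s01 i Pi.
by have /convex_setP := cC i; apply => //; [exact: Cx|exact: Cy].
Qed.

Lemma convex_norm_ball (X : R) : convex_set [set x : V | `|x| <= X].
Proof.
apply/convex_setP => x y s /= xX yX /andP[s0 s1].
apply: le_trans (ler_normD _ _) _; rewrite !normrZ !ger0_norm ?subr_ge0 //; nra.
Qed.

(** The final inequality compares volumes: [Q] spans a parallelepiped inside [K],
    which lies in the [5 d]-fold enlargement of the one spanned by [M]. *)
Lemma bounded_convex_sandwich (K : set V) (X : R) q (Q : 'M[R]_d) : convex_set K ->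
  (forall x, K x -> `|x| <= X) -> \det Q != 0 -> parallelepiped q Q `<=` K ->
  exists p M, sandwiches (5 * d)%:R p M K /\
    2 ^+ d * `|\det Q| <= (15 * d)%:R ^+ d * `|\det M|.
Proof.
move=> cK KX Q0 QK.
have Kq : K q by apply: QK; exists 0; rewrite /= ?normr0 ?ler01 // mul0mx addr0.
have X0 : 0 < X + 1 by apply: lt_le_trans (_ : 0 < `|q| + 1) _; [rewrite ltr_wpDl|rewrite lerD2r KX].
have Kcube : K `<=` parallelepiped 0 ((X + 1) *: 1%:M).
  move=> x /KX xX; apply/parallelepipedZ => //; exists x; last by rewrite add0r mulmx1.
  by rewrite (le_trans xX) // lerDl.
have c0 : 0 < (2 * d%:R)^-1 :> R by rewrite invr_gt0 mulr_gt0 // ltr0n.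
have [||p [M [M0 MK KM]]] := convex_parallelepiped_sandwich (K := K)
    (B := (2 ^+ d * (2 * d%:R)^-1 ^+ d)^-1 * (3 ^+ d * `|\det ((X + 1) *: (1%:M : 'M[R]_d))|)) cK.
- move=> v A KA; have := det_le_parallelepiped
    (subset_trans (parallelepiped_sub_simplex cK KA) Kcube).
  rewrite detZ normrM [`|_ ^-1 ^+ _|]ger0_norm ?exprn_ge0 ?(ltW c0) // mulrA => h.
  by rewrite ler_pdivlMl ?mulr_gt0 ?exprn_gt0.
- exists q, Q; split => //; split => // i; apply: QK; exists (delta_mx 0 i).
    apply/rV_norm_leP => // k; rewrite mxE normr_nat; by case: (_ && _).
  by rewrite -rowE.
exists p, M; split => //.
have := det_le_parallelepiped (subset_trans QK KM); rewrite detZ normrM normrX ger0_norm ?ler0n //.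
by rewrite mulrA -exprMn -natrM mulnA.
Qed.

(** The affine form of [exists_drop_one_bounded], in the coordinates in which the
    inner parallelepiped is the unit cube. *)
Lemma exists_sandwich_drop_one m : (2 * d < m)%N ->
  exists2 F : R, 1 <= F & forall (I : finType) (C : I -> set V) (S : {set I}) p M,
    #|S| = m -> (forall i, convex_set (C i)) ->
    sandwiches (5 * d)%:R p M (\bigcap_(i in [set` S]) C i) ->
    exists2 i, i \in S & sandwiches F p M (\bigcap_(j in [set` (S :\ i)%SET]) C j).
Proof.
move=> dm; have [F F0 FP] := exists_drop_one_bounded (R := R) (5 * d)%:R dm.
exists (Num.max 1 F); first by rewrite le_max lexx.
move=> I C S p M cS cC [M0 MS SM].
have uM : M \in unitmx by rewrite unitmxE unitfE.
pose e (k : 'I_m) : I := enum_val (cast_ord (esym cS) k).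
have eS k : e k \in S by exact: enum_valP.
have e_inj : injective e by move=> k l /enum_val_inj/cast_ord_inj.
have e_surj j : j \in S -> exists k, e k = j.
  move=> jS; exists (cast_ord cS (enum_rank_in jS j)).
  by rewrite /e cast_ord_comp cast_ord_id enum_rankK_in.
pose C' k : set V := [set t | C (e k) (p + t *m M)].
have [k|k t t1|t Ct|k kP] := FP C'.
- apply/convex_setP => x y s Cx Cy s01; have /convex_setP := cC (e k).
  move=> /(_ _ _ _ Cx Cy s01); congr (C _ _).
  rewrite mulmxDl -!scalemxAl !scalerDr addrACA -scalerDl [s + _]addrC subrK.
  by rewrite scale1r.
- by apply: (MS (p + t *m M)); [exists t|exact: eS].
- have : (\bigcap_(i in [set` S]) C i) (p + t *m M).
    by move=> j /= /e_surj[k <-]; exact: Ct.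
  move=> /SM /(parallelepipedZ _ _ _ _)[|t' t'r]; first by rewrite ltr0n.
  by move=> /addrI/(can_inj (mulmxK uM)) ->.
exists (e k) => //; split => //.
  by apply: subset_trans MS _ => x Cx j /=; rewrite in_setD1 => /andP[_ jS]; exact: Cx.
move=> x Cx; apply/parallelepipedZ; first by rewrite lt_max ltr01.
have xE : x = p + ((x - p) *m invmx M) *m M by rewrite mulmxKV // addrC subrK.
exists ((x - p) *m invmx M) => //; rewrite le_max; apply/orP; right; apply: kP => l lk.
rewrite /C' /= -xE; apply: Cx => /=; rewrite in_setD1 eS andbT.
by apply: contra lk => /eqP/e_inj ->.
Qed.

End Selection.

Section DimensionOne.
Variable (R : realType).
Local Notation V := 'rV[R]_1.

Lemma convex_between (K : set V) (x y z : V) : convex_set K -> K x -> K z ->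
  x 0 0 <= y 0 0 <= z 0 0 -> K y.
Proof.
move=> /convex_setP cK Kx Kz /andP[xy yz].
have [xz|xz] := eqVneq (x 0 0) (z 0 0).
  by rewrite (_ : y = x) //; apply/rowP => i; rewrite ord1; apply/eqP; rewrite eq_le xy xz yz.
have xz0 : 0 < z 0 0 - x 0 0 by rewrite subr_gt0 lt_neqAle xz (le_trans xy).
pose s := (z 0 0 - y 0 0) / (z 0 0 - x 0 0).
have s01 : 0 <= s <= 1.
  by rewrite divr_ge0 ?subr_ge0 ?(ltW xz0) ?(le_trans xy) //= ler_pdivrMr // mul1r lerD2l lerN2.
have := cK x z s Kx Kz s01; congr K; apply/rowP => i; rewrite ord1 !mxE /s.
by field; rewrite gt_eqF.
Qed.

(** Otherwise each of three members [i] has a point [x i] that lies in all the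
    other members but not in it; the middle one of the three points lies between
    two points of its own convex set. *)
Lemma interval_drop_one (I : finType) (C : I -> set V) (S : {set I}) :
  (2 < #|S|)%N -> (forall i, convex_set (C i)) ->
  exists2 i, i \in S & \bigcap_(j in [set` (S :\ i)%SET]) C j `<=` C i.
Proof.
move=> S2 cC; apply: contrapT => none.
have /choice[x xP] : forall i, exists x : V, i \in S ->
    (\bigcap_(j in [set` (S :\ i)%SET]) C j) x /\ ~ C i x.
  move=> i; have [iS|] := boolP (i \in S); last by exists 0.
  apply: contrapT => nx; apply: none; exists i => // x Cx.
  by apply: contrapT => nCx; apply: nx; exists x.
have key a b c : a \in S -> b \in S -> c \in S -> a != b -> b != c ->
    x a 0 0 <= x b 0 0 -> x b 0 0 <= x c 0 0 -> False.
  move=> aS bS cS ab bc xab xbc.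
  have [Ca _] := xP a aS; have [_ nCb] := xP b bS; have [Cc _] := xP c cS.
  apply/nCb/(@convex_between _ (x a) _ (x c)) => //; last by rewrite xab.
    by apply: Ca; rewrite /= in_setD1 eq_sym ab.
  by apply: Cc; rewrite /= in_setD1 bc.
have /card_gt2P[a [b [c [[aS bS cS] [ab bc ca]]]]] := S2.
have ba : b != a by rewrite eq_sym.
have cb : c != b by rewrite eq_sym.
have ac : a != c by rewrite eq_sym.
case/orP: (le_total (x a 0 0) (x b 0 0)) => xab.
  case/orP: (le_total (x b 0 0) (x c 0 0)) => xbc; first exact: (key a b c).
  case/orP: (le_total (x a 0 0) (x c 0 0)) => xac; first exact: (key a c b).
  exact: (key c a b).
case/orP: (le_total (x a 0 0) (x c 0 0)) => xac; first exact: (key b a c).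
case/orP: (le_total (x b 0 0) (x c 0 0)) => xbc; first exact: (key b c a).
exact: (key c b a).
Qed.

End DimensionOne.

(** * Assembling the fractional theorem *)

Section DenseFamilies.
Variable R : realType.

Lemma density_itv (alpha : R) k : 0 < alpha < 1 -> 0 < alpha / k.+1%:R < 1.
Proof.
move=> /andP[a0 a1]; rewrite divr_gt0 ?ltr0n //= ltr_pdivrMr ?ltr0n // mul1r.
by apply: lt_le_trans a1 _; rewrite ler1n.
Qed.

Lemma fractional_helly_interval (alpha : R) : 0 < alpha < 1 ->
  exists2 beta : R, 0 < beta < 1 &
  forall (I : finType) (C : I -> set 'rV[R]_1) (G : {set {set I}}) (r : \bar R),
    (4 <= #|I|)%N -> (forall i, convex_set (C i)) ->
    {in G, forall S : {set I}, #|S| = 4%N /\ (r <= volume (\bigcap_(i in [set` S]) C i))%E} ->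
    alpha * 'C(#|I|, 4)%:R <= #|G|%:R ->
    exists S : {set I}, beta * #|I|%:R <= #|S|%:R /\
      (r <= volume (\bigcap_(i in [set` S]) C i))%E.
Proof.
move=> a01; exists (alpha / ((4 ^ 2 * #|{: unit}|).+1)%:R); first exact: density_itv.
move=> I C G r I4 cC GP aG.
have /choice[drop dropP] : forall S : {set I}, exists i, S \in G ->
    i \in S /\ \bigcap_(j in [set` (S :\ i)%SET]) C j `<=` C i.
  move=> S; have [/GP[cS _]|] := boolP (S \in G).
    by have [|i iS Si] := @interval_drop_one R I C S _ cC; [rewrite cS|exists i].
  by have /card_gt0P[i _] : (0 < #|I|)%N; [lia|exists i].
have /andP[a0 _] := a01.
have [S SG|B [k BT]] := @exists_dense_extensions I unit 3 G drop (fun=> tt) _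
  R alpha a0 I4 aG.
  by split; [exact: (GP S SG).1|exact: (dropP S SG).1].
set T := extensions _ _ _ _ _ in BT; exists T; split => //.
have TP i : i \in T -> i |: B \in G /\ \bigcap_(j in [set` B]) C j `<=` C i.
  rewrite finset.in_set => /and4P[iB BG /eqP di _]; split => //.
  by have [_] := dropP _ BG; rewrite di finset.setU1K.
have /card_gt0P[i iT] : (0 < #|T|)%N.
  rewrite -(ltr0n R); apply: lt_le_trans BT; rewrite mulr_gt0 ?ltr0n //; last by lia.
  by rewrite divr_gt0 ?ltr0n.
have [BG _] := TP i iT.
apply: le_trans (GP _ BG).2 _; apply: le_volume => x Cx j /= /TP[_]; apply.
by move=> l /= lB; apply: Cx; rewrite /= in_setU1 lB orbT.
Qed.

(** With [d = n + 1 >= 2] this is [225 ^ d * d ^ (2 d) <= 2 ^ d * d ^ (9 d ^ 2)],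
    and [225 <= 2 * 2 ^ 7 <= 2 * d ^ 7]. *)
Lemma core_volume_bound n : (0 < n)%N ->
  (n.+1%:R `^ (- (9 * n.+1%:R ^+ 2)) : R) <= 2 ^+ n.+1 * ((15 * n.+1)%:R ^- n.+1) ^+ 2.
Proof.
move=> n0; set d := n.+1.
rewrite powRN -natrX -natrM powR_mulrn // -natrX.
rewrite exprVn -[leRHS]invf_div lef_pV2 ?posrE ?divr_gt0 ?exprn_gt0 ?ltr0n ?expn_gt0 //.
rewrite ler_pdivrMr ?exprn_gt0 // -!natrX -natrM ler_nat.
rewrite -expnM [(d * 2)%N]mulnC expnM.
have d2 : (2 <= d)%N by [].
apply: (@leq_trans ((2 * d ^ 9) ^ d)); last first.
  by rewrite expnMn [leqLHS]mulnC leq_mul2r -expnM leq_pexp2l ?orbT // -mulnn mulnA leq_pmulr.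
rewrite leq_exp2r // expnMn (_ : 9 = 7 + 2)%N // expnD mulnA leq_mul2r.
have : (2 ^ 7 <= d ^ 7)%N by rewrite leq_exp2r.
by move: (d ^ 7)%N => D; lia.
Qed.

(** The intersections may be unbounded, so the sets are first cut down to a ball
    [`|x| <= X] that contains a large parallelepiped [q S] in the intersection of
    each [S] in [G]. Each [S] then gets a sandwiching parallelepiped [fr S], a member
    [drop S], and as label the colour of [fr S] relative to a reference [rf B]
    that depends on [B = S :\ drop S] only. *)
Lemma fractional_helly_core n (alpha : R) : 0 < alpha < 1 ->
  exists2 beta : R, 0 < beta < 1 &
  forall (I : finType) (C : I -> set 'rV[R]_n.+1) (G : {set {set I}}),
    (3 * n.+1 + 1 <= #|I|)%N -> (forall i, convex_set (C i)) ->
    {in G, forall S : {set I}, #|S| = (3 * n.+1 + 1)%N /\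
      (1 <= volume (\bigcap_(i in [set` S]) C i))%E} ->
    alpha * 'C(#|I|, 3 * n.+1 + 1)%:R <= #|G|%:R ->
    exists S : {set I}, beta * #|I|%:R <= #|S|%:R /\
      ((2 ^+ n.+1 * ((15 * n.+1)%:R ^- n.+1) ^+ 2)%:E
         <= volume (\bigcap_(i in [set` S]) C i))%E.
Proof.
move=> a01; set d := n.+1; rewrite !addn1.
have /andP[a0 _] := a01.
have [|F F1 dropF] := @exists_sandwich_drop_one R n (3 * d).+1; first by rewrite /d; lia.
have [K [col colP]] := @exists_common_core_coloring R n F F1.
exists (alpha / (((3 * d).+1 ^ 2 * #|K|).+1)%:R); first exact: density_itv.
move=> I C G cI cC GP aG.
have /choice[q qP] : forall S : {set I}, exists q : 'rV[R]_d * 'M[R]_d, S \in G ->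
    parallelepiped q.1 q.2 `<=` \bigcap_(i in [set` S]) C i /\
    (15 * d)%:R ^- d <= `|\det q.2|.
  move=> S; have [/GP[_ volS]|] := boolP (S \in G); last by exists (0, 0).
  by have [p [M [pM dM]]] := convex_volume_ge1 (convex_bigcap cC) volS; exists (p, M).
pose X : R := \sum_(S : {set I}) (`|(q S).1| + d%:R * `|(q S).2|).
pose C' i := C i `&` [set x : 'rV[R]_d | `|x| <= X].
pose L (S : {set I}) := \bigcap_(i in [set` S]) C' i.
have cC' i : convex_set (C' i) by apply: convex_setI => //; exact: convex_norm_ball.
have c15 : 0 < (15 * d)%:R ^+ d :> R by rewrite exprn_gt0 // ltr0n.
have /choice[fr frP] : forall S : {set I}, exists pM : 'rV[R]_d * 'M[R]_d, S \in G ->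
    sandwiches (5 * d)%:R pM.1 pM.2 (L S) /\
    2 ^+ d * ((15 * d)%:R ^- d) ^+ 2 <= `|\det pM.2|.
  move=> S; have [SG|] := boolP (S \in G); last by exists (0, 0).
  have [qS dS] := qP S SG.
  have q0 : \det (q S).2 != 0.
    by rewrite -normr_gt0; apply: lt_le_trans dS; rewrite invr_gt0.
  have /card_gt0P[i0 i0S] : (0 < #|S|)%N by rewrite (GP S SG).1.
  have qL : parallelepiped (q S).1 (q S).2 `<=` L S.
    move=> x qx i iS; split; first exact: qS qx i iS.
    case: qx => t /= t1 <-; rewrite /X (bigD1 S) //=.
    apply: (@le_trans _ _ (`|(q S).1| + d%:R * `|(q S).2|)).
      apply: le_trans (ler_normD _ _) _; rewrite lerD2l; apply: rV_mulmx_norm_le => // k l.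
      rewrite [leRHS]mx_normrE; exact: (le_bigmax _ (fun kl => `|(q S).2 kl.1 kl.2|) (k, l)).
    by rewrite lerDl; apply: sumr_ge0 => S' _; rewrite addr_ge0 // mulr_ge0.
  have LX x : L S x -> `|x| <= X by move=> /(_ i0 i0S)[].
  have [p [M [sM dM]]] := bounded_convex_sandwich (convex_bigcap cC') LX q0 qL.
  exists (p, M) => _; split => //=.
  rewrite expr2 mulrA ler_pdivrMr // [leRHS]mulrC; apply: le_trans dM.
  by rewrite ler_pM2l ?exprn_gt0.
have /choice[drop dropP] : forall S : {set I}, exists i, S \in G ->
    i \in S /\ sandwiches F (fr S).1 (fr S).2 (L (S :\ i)%SET).
  move=> S; have [SG|] := boolP (S \in G).
    have [i iS Si] := dropF I C' S _ _ (GP S SG).1 cC' (frP S SG).1; by exists i.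
  by have /card_gt0P[i _] : (0 < #|I|)%N; [lia|exists i].
have /choice[rf rfP] : forall B : {set I}, exists pM : 'rV[R]_d * 'M[R]_d,
    forall p M, sandwiches F p M (L B) -> sandwiches F pM.1 pM.2 (L B).
  move=> B; have [[p [M pM]]|no] := pselect (exists p M, sandwiches F p M (L B)).
    by exists (p, M).
  by exists (0, 0) => p M pM; exfalso; apply: no; exists p, M.
pose color S := let rS := rf (S :\ drop S)%SET in col rS.1 rS.2 (fr S).1 (fr S).2.
have [S SG|B [k BT]] := @exists_dense_extensions I K (3 * d) G drop color _
  R alpha a0 cI aG.
  by split; [exact: (GP S SG).1|exact: (dropP S SG).1].
set T := extensions _ _ _ _ _ in BT; exists T; split => //.
have TP i : i \in T -> [/\ i |: B \in G, sandwiches F (fr (i |: B)).1 (fr (i |: B)).2 (L B) &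
    col (rf B).1 (rf B).2 (fr (i |: B)).1 (fr (i |: B)).2 = k].
  rewrite finset.in_set => /and4P[iB BG /eqP di /eqP ck]; have [_] := dropP _ BG.
  by rewrite di finset.setU1K // => sB; split => //; rewrite -ck /color di finset.setU1K.
have /card_gt0P[i1 i1T] : (0 < #|T|)%N.
  rewrite -(ltr0n R); apply: lt_le_trans BT; rewrite mulr_gt0 ?ltr0n //; last by lia.
  by rewrite divr_gt0 ?ltr0n.
have [BG1 sB1 col1] := TP i1 i1T; set S1 := i1 |: B in BG1 sB1 col1.
have coreC : parallelepiped (fr S1).1 (2^-1 *: (fr S1).2) `<=` \bigcap_(i in [set` T]) C i.
  move=> x x1 i /= iT; have [BG sB coli] := TP i iT.
  have := colP _ _ _ _ _ _ _ (rfP _ _ _ sB) sB sB1 _ x x1; rewrite coli col1 => /(_ erefl) xi.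
  have [[_ frL _] _] := frP _ BG.
  by have [] := frL x xi i (finset.setU11 _ _).
apply: le_trans _ (le_volume coreC); apply: le_trans _ (volume_parallelepiped_ge _ _).
rewrite lee_fin; apply: le_trans (frP _ BG1).2 _.
rewrite detZ normrM normrX [`|2^-1|]gtr0_norm ?invr_gt0 // exprVn.
by rewrite mulVKf ?expf_neq0 ?pnatr_eq0.
Qed.

End DenseFamilies.

Theorem theorem1p1 (R : realType) :
  exists2 c : R, 0 < c &
  forall (d : nat) (alpha : R), (1 <= d)%N -> 0 < alpha < 1 ->
  exists2 beta : R, 0 < beta < 1 &
  forall (I : finType) (C : I -> set 'rV[R]_d),
    (3 * d + 1 <= #|I|)%N ->
    (forall i, convex_set (C i)) ->
    alpha * 'C(#|I|, 3 * d + 1)%:R <=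
      #|[pred S : {set I} | (#|S| == 3 * d + 1)%N &&
          `[< (1 <= volume (\bigcap_(i in [set` S]) C i))%E >]]|%:R ->
    exists S : {set I},
      beta * #|I|%:R <= #|S|%:R /\
      ((d%:R `^ (- (c * d%:R ^+ 2)))%:E
         <= volume (\bigcap_(i in [set` S]) C i))%E.
Proof.
exists 9; first by [].
pose P d (I : finType) (C : I -> set 'rV[R]_d) (S : {set I}) :=
  (#|S| == 3 * d + 1)%N && `[< (1 <= volume (\bigcap_(i in [set` S]) C i))%E >].
have GP d (I : finType) (C : I -> set 'rV[R]_d) :
    {in [set S | P d I C S]%SET, forall S : {set I}, #|S| = (3 * d + 1)%N /\
      (1 <= volume (\bigcap_(i in [set` S]) C i))%E}.
  by move=> S; rewrite finset.in_set => /andP[/eqP -> /asboolP].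
have GE d (I : finType) (C : I -> set 'rV[R]_d) :
    #|[set S | P d I C S]%SET| = #|[pred S | P d I C S]|.
  by rewrite cardsE.
move=> [//|[|n]] alpha _ a01.
  have [beta b01 H] := fractional_helly_interval a01; exists beta => // I C I4 cC aG.
  have [|S [bS vS]] := H I C _ 1%E I4 cC (GP _ I C); first by rewrite GE; exact: aG.
  by exists S; rewrite powR1.
have [beta b01 H] := fractional_helly_core n.+1 a01; exists beta => // I C I4 cC aG.
have [|S [bS vS]] := H I C _ I4 cC (GP _ I C); first by rewrite GE; exact: aG.
by exists S; split => //; apply: le_trans vS; rewrite lee_fin; exact: core_volume_bound.
Qed.
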